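(* Let $G=G_1\ast_A G_2$ be an amalgam of finite groups. Given $h_1,\ldots,h_k\in G$, there exists an algorithm which decides whether or not the subgroup $H=\langle h_1,\ldots,h_k\rangle$ is a free subgroup of $G$.
   Context: Setting: $G=G_1\ast_A G_2$ is a free product with amalgamation of finite groups $G_1=\langle X_1\mid R_1\rangle$ and $G_2=\langle X_2\mid R_2\rangle$, given by finite presentations with $X_1^{\pm}\cap X_2^{\pm}=\emptyset$, along a group $A=\langle Y\rangle$ with monomorphisms $\phi_i:A\to G_i$ ($i=1,2$), so $G=\langle X_1\cup X_2\mid R_1,R_2,\phi_1(a)=\phi_2(a)\ (a\in Y)\rangle$. All this data (including the Cayley graphs and relative Cayley graphs of $G_1,G_2$) is fixed and given. The input of the algorithm is the finite list $h_1,\ldots,h_k$, given as words over $(X_1\cup X_2)^{\pm}$. *)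

(* Defs.v *)
From HB Require Import structures.
From mathcomp Require Import all_boot all_fingroup.

Set Implicit Arguments.
Unset Strict Implicit.
Unset Printing Implicit Defensive.

Local Open Scope group_scope.

(** * Words and presentations *)

(* A word over X^{+-}: the letter (x, false) is x and (x, true) is x^-1. *)
Definition word (X : Type) : Type := seq (X * bool).

Definition word_inv (X : Type) (w : word X) : word X :=
  rev [seq (l.1, ~~ l.2) | l <- w].

Definition word_map (X Z : Type) (f : X -> Z) (w : word X) : word Z :=
  [seq (f l.1, l.2) | l <- w].

Definition word_val (G : groupType) (X : Type) (e : X -> G) (w : word X) : G :=
  \prod_(l <- w) (if l.2 then (e l.1)^-1 else e l.1).

(* Two words are equal in the group < X | R > iff one is obtained from the
   other by inserting and deleting relators and subwords x x^-1, x^-1 x. *)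
Inductive word_eq (X : Type) (R : word X -> Prop) : word X -> word X -> Prop :=
| word_eq_refl w : word_eq R w w
| word_eq_sym w1 w2 : word_eq R w1 w2 -> word_eq R w2 w1
| word_eq_trans w1 w2 w3 :
    word_eq R w1 w2 -> word_eq R w2 w3 -> word_eq R w1 w3
| word_eq_cancel u x b v :
    word_eq R (u ++ [:: (x, b); (x, ~~ b)] ++ v) (u ++ v)
| word_eq_relator u r v : R r -> word_eq R (u ++ r ++ v) (u ++ v).

(* The subgroup generated by a family: the values of all words in it. *)
Definition generated_by (G : groupType) (X : Type) (e : X -> G) (g : G) : Prop :=
  exists w : word X, word_val e w = g.

(* H = < X | R > via e, i.e. e induces an isomorphism from the words over X
   modulo word_eq R onto the subgroup H of G. *)
Definition presents (G : groupType) (H : G -> Prop)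
    (X : Type) (e : X -> G) (R : word X -> Prop) : Prop :=
  (forall g, H g <-> generated_by e g) /\
  (forall w1 w2, word_val e w1 = word_val e w2 <-> word_eq R w1 w2).

(* H is isomorphic to the free group on some set S, possibly empty: without
   relators, word_eq is free equality. *)
Definition is_free (G : groupType) (H : G -> Prop) : Prop :=
  exists (S : Type) (b : S -> G), presents H b (fun _ => False).

(** * Amalgams *)

(* The relators of < X1, X2 | R1, R2, phi1 a = phi2 a (a in Y) >. The words
   u and v stand for phi1 a and phi2 a; admitting all such words rather than
   a chosen one only adds consequences of R1 and R2. *)
Inductive amalgam_relator (X1 X2 : finType) (R1 : seq (word X1))
    (R2 : seq (word X2)) (G1 G2 : groupType) (e1 : X1 -> G1) (e2 : X2 -> G2)
    (A : finType) (Y : {set A}) (phi1 : A -> G1) (phi2 : A -> G2) :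
    word (X1 + X2) -> Prop :=
| amalgam_relator1 r : r \in R1 ->
    amalgam_relator R1 R2 e1 e2 Y phi1 phi2 (word_map inl r)
| amalgam_relator2 r : r \in R2 ->
    amalgam_relator R1 R2 e1 e2 Y phi1 phi2 (word_map inr r)
| amalgam_relatorA a u v :
    a \in Y -> word_val e1 u = phi1 a -> word_val e2 v = phi2 a ->
    amalgam_relator R1 R2 e1 e2 Y phi1 phi2
      (word_map inl u ++ word_inv (word_map inr v)).

(** * Algorithms: Kleene's partial recursive functions *)

Inductive recfun : nat -> Type :=
| RZero : recfun 0
| RSucc : recfun 1
| RProj n (i : 'I_n) : recfun n
| RComp m n (f : recfun m) (g : 'I_m -> recfun n) : recfun n
| RPrec n (f : recfun n) (g : recfun n.+2) : recfun n.+1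
| RMin n (f : recfun n.+1) : recfun n.

(* k steps of primitive recursion, as a relation: F is the graph of the
   initial function, S k z y means that the step function sends (k, z) to y. *)
Fixpoint prec_graph (F : nat -> Prop) (S : nat -> nat -> nat -> Prop)
    (k y : nat) : Prop :=
  if k is k'.+1 then exists2 z, prec_graph F S k' z & S k' z y else F y.

(* computes f v y: the computation of f on input v halts with output y. *)
Fixpoint computes n (f : recfun n) : n.-tuple nat -> nat -> Prop :=
  match f in recfun n return n.-tuple nat -> nat -> Prop with
  | RZero => fun _ y => y = 0
  | RSucc => fun v y => y = (thead v).+1
  | RProj _ i => fun v y => y = tnth v i
  | RComp m _ f g => fun v y =>
      exists2 w : m.-tuple nat,
        forall i, computes (g i) v (tnth w i) & computes f w y
  | RPrec _ f g => fun v y =>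
      prec_graph (computes f (behead_tuple v))
        (fun k z => computes g [tuple of k :: z :: behead_tuple v])
        (thead v) y
  | RMin _ f => fun v y =>
      computes f [tuple of y :: v] 0 /\
      forall z, z < y -> exists t, computes f [tuple of z :: v] t.+1
  end.

Lemma computes_fun n (f : recfun n) v y1 y2 :
  computes f v y1 -> computes f v y2 -> y1 = y2.
Proof.
elim: n / f v y1 y2 => [|| n i | m n f IHf g IHg | n f IHf g IHg | n f IHf]
  v y1 y2 /=; try by move=> -> ->.
- case=> w1 gw1 fw1 [w2 gw2 fw2].
  have eqw : w1 = w2 by apply: eq_from_tnth => i; apply: IHg (gw1 i) (gw2 i).
  by rewrite -eqw in fw2; apply: IHf fw1 fw2.
- elim: (thead v) y1 y2 => [|k IHk] y1 y2 /=; first exact: IHf.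
  case=> z1 z1P y1P [z2 z2P y2P].
  by rewrite (IHk _ _ z1P z2P) in y1P; apply: IHg y1P y2P.
- move=> [f1 lt1] [f2 lt2]; case: (ltngtP y1 y2) => // lty.
  + by have [t ft] := lt2 _ lty; have := IHf _ _ _ f1 ft.
  + by have [t ft] := lt1 _ lty; have := IHf _ _ _ f2 ft.
Qed.

(* Goedel number of a list of words over a finite alphabet. *)
Definition words_code (X : finType) (hs : seq (word X)) : nat :=
  CodeSeq.code
    [seq CodeSeq.code [seq nat_of_ord (enum_rank l) | l <- h] | h <- hs].

(* f halts on the code of every list of words, with output 1 if P holds and 0 otherwise. *)
Definition decides (X : finType) (f : recfun 1) (P : seq (word X) -> Prop) :
    Prop :=
  forall hs : seq (word X),
    (P hs -> computes f [tuple words_code hs] 1) /\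
    (~ P hs -> computes f [tuple words_code hs] 0).

(* Main.v *)
Require Import Defs.
From HB Require Import structures.
From mathcomp Require Import all_boot all_fingroup.
From mathcomp Require Import boolp.
From mathcomp Require classical_sets.

(* A finitely generated subgroup [H] of [G] is free iff it meets every conjugate
   of [G1] and [G2] trivially: if it does, the quotient of the Bass-Serre tree by
   [H] is a graph whose fundamental group is [H], and conversely free groups are
   torsion-free.

   This is decidable because [H] is then contained in a subgroup with the same
   property and of an index computed from the generators. The points of [H \ G]
   visited while reading the generators, closed under the actions of [G1] and of
   [G2], form a finite set on parts of which [G1] and [G2] act freely. Adding
   free [A]-orbits until the cardinal is a given large multiple of
   [#|G1| * #|G2|] makes both actions extend to free actions of the factors on
   the whole set, compatible on [A]. Conversely any such action in which the
   generators fix a point shows that [H] meets the conjugates of the factors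
   trivially. So it suffices to search the actions on a set of a cardinal
   computed from the input. *)

Set Implicit Arguments.
Unset Strict Implicit.
Unset Printing Implicit Defensive.

Local Open Scope group_scope.

(** * Words *)

(** The Bass-Serre tree is never built. Its vertices enter only through the double cosets of [H],
    and the property of being a tree is replaced by the presentation of [G]: a map into a free group
    is defined letter by letter and respects the relators, and this map shows that a generating set
    of [H] is a basis. Conversely, when [H] fixes a point, an element of [H] conjugate to an element
    of a factor makes the latter fix a point too, so it is trivial. The search does not decide
    equality in [G]: cosets and chosen representatives occur only in the proof of correctness, which
    can be classical. All that the algorithm retains of [G] is two finite lists of words, those that
    must act trivially and those that must fix no point. The presentation does not say outright that
    the factors embed in [G]; this also comes from extending actions, starting from the empty
    set. *)

Section Words.
Variables (G : groupType) (X : Type) (e : X -> G).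
Implicit Types (u v w : word X) (R : word X -> Prop).

Lemma word_val_nil : word_val e [::] = 1.
Proof. by rewrite /word_val big_nil. Qed.

Lemma word_val_cons l w :
  word_val e (l :: w) = (if l.2 then (e l.1)^-1 else e l.1) * word_val e w.
Proof. by rewrite /word_val big_cons. Qed.

Lemma word_val_cat u v : word_val e (u ++ v) = word_val e u * word_val e v.
Proof. by rewrite /word_val big_cat. Qed.

Lemma word_inv_cons l w : word_inv (l :: w) = word_inv w ++ [:: (l.1, ~~ l.2)].
Proof. by rewrite /word_inv /= rev_cons cats1. Qed.

Lemma word_inv_cat u v : word_inv (u ++ v) = word_inv v ++ word_inv u.
Proof. by rewrite /word_inv map_cat rev_cat. Qed.

Lemma word_invK w : word_inv (word_inv w) = w.
Proof.
elim: w => // -[x b] w IHw.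
by rewrite word_inv_cons word_inv_cat IHw /= negbK.
Qed.

Lemma word_val_inv w : word_val e (word_inv w) = (word_val e w)^-1.
Proof.
elim: w => [|[x b] w IHw]; first by rewrite /word_inv word_val_nil invg1.
rewrite word_inv_cons word_val_cat IHw !word_val_cons word_val_nil mulg1 invMg.
by case: b => /=; rewrite ?invgK.
Qed.

Lemma word_eq_relator1 R r : R r -> word_eq R r [::].
Proof. by move=> Rr; have := word_eq_relator [::] [::] Rr; rewrite !cats0. Qed.

Lemma word_eq_cong R u v w1 w2 :
  word_eq R w1 w2 -> word_eq R (u ++ w1 ++ v) (u ++ w2 ++ v).
Proof.
elim=> [w|w w' _|w w' w'' _ IH1 _ IH2|u' x b v'|u' r v' Rr].
- exact: word_eq_refl.
- exact: word_eq_sym.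
- exact: word_eq_trans IH1 IH2.
- rewrite -!catA !catA -(catA _ v') -[_ ++ [:: _; _]]catA.
  rewrite -!catA [u ++ u' ++ _]catA [u ++ u' ++ v' ++ _]catA.
  exact: (word_eq_cancel _ (u ++ u') x b (v' ++ v)).
- rewrite -!catA [u ++ u' ++ _]catA [u ++ u' ++ v' ++ _]catA.
  exact: word_eq_relator.
Qed.

Lemma word_eq_cat R u1 u2 v1 v2 :
  word_eq R u1 u2 -> word_eq R v1 v2 -> word_eq R (u1 ++ v1) (u2 ++ v2).
Proof.
move=> equ eqv; apply: (word_eq_trans (w2 := u2 ++ v1)).
  exact: (word_eq_cong [::] v1 equ).
by have := word_eq_cong u2 [::] eqv; rewrite !cats0.
Qed.

Lemma word_eq_mulV R w : word_eq R (w ++ word_inv w) [::].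
Proof.
elim: w => [|[x b] w IHw]; first exact: word_eq_refl.
rewrite word_inv_cons catA -cat1s -catA.
apply: word_eq_trans (word_eq_cancel R [::] x b [::]).
by have := word_eq_cong [:: (x, b)] [:: (x, ~~ b)] IHw; rewrite -catA.
Qed.

Lemma word_eq_Vmul R w : word_eq R (word_inv w ++ w) [::].
Proof. by rewrite -{2}[w]word_invK; apply: word_eq_mulV. Qed.

Lemma word_eq_invl R u v : word_eq R (u ++ v) [::] -> word_eq R u (word_inv v).
Proof.
move=> uv1; apply: (word_eq_trans (w2 := (u ++ v) ++ word_inv v)); last first.
  exact: (word_eq_cat uv1 (word_eq_refl R (word_inv v))).
rewrite -catA -{1}[u]cats0; apply: word_eq_cat (word_eq_refl R u) _.
exact/word_eq_sym/word_eq_mulV.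
Qed.

Lemma word_eq_val R u v : (forall r, R r -> word_val e r = 1) ->
  word_eq R u v -> word_val e u = word_val e v.
Proof.
move=> R1; elim=> [//|w w' _ ->//|w w' w'' _ -> _ ->//|u' x b v'|u' r v' /R1 r1].
  rewrite !word_val_cat !word_val_cons word_val_nil mulg1 /=.
  by case: b; rewrite /= ?mulgV ?mulVg mul1g.
by rewrite !word_val_cat r1 mul1g.
Qed.

End Words.

Lemma word_val_map (G : groupType) (X Z : Type) (f : X -> Z) (e : Z -> G) w :
  word_val e (word_map f w) = word_val (e \o f) w.
Proof. by rewrite /word_val big_map. Qed.

Lemma word_inv_map (X Z : Type) (f : X -> Z) w :
  word_inv (word_map f w) = word_map f (word_inv w).
Proof. by rewrite /word_inv /word_map map_rev -!map_comp. Qed.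

Record is_subgroup (G : groupType) (H : G -> Prop) : Prop := IsSubgroup {
  subgroup1 : H 1;
  subgroupM : forall x y, H x -> H y -> H (x * y);
  subgroupV : forall x, H x -> H x^-1 }.

Lemma generated_subgroup (G : groupType) X (e : X -> G) :
  is_subgroup (generated_by e).
Proof.
split; first by exists [::]; rewrite word_val_nil.
  by move=> _ _ [u <-] [v <-]; exists (u ++ v); rewrite word_val_cat.
by move=> _ [u <-]; exists (word_inv u); rewrite word_val_inv.
Qed.

Lemma generated_gen (G : groupType) X (e : X -> G) x : generated_by e (e x).
Proof. by exists [:: (x, false)]; rewrite word_val_cons word_val_nil mulg1. Qed.

Lemma generated_le (G : groupType) X (e : X -> G) H :
  is_subgroup H -> (forall x, H (e x)) -> forall g, generated_by e g -> H g.
Proof.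
move=> sgH He _ [w <-]; elim: w => [|[x b] w IHw].
  by rewrite word_val_nil; apply: subgroup1.
rewrite word_val_cons; apply: subgroupM => //=.
by case: b; [apply: subgroupV|].
Qed.

(** * Equivariant transversals *)

Section TreeTransversal.
Variables (G : groupType) (H : G -> Prop) (K : bool -> G -> Prop).
Hypothesis sgH : is_subgroup H.
Hypothesis sgK : forall i, is_subgroup (K i).
Hypothesis genK : forall P : G -> Prop, P 1 ->
  (forall g k i, P g -> K i k -> P (g * k)) -> forall g, P g.
Hypothesis freeK : forall i g k, K i k -> H (g * k * g^-1) -> k = 1.

Let HM := subgroupM sgH.
Let HV := subgroupV sgH.
Let KM i := subgroupM (sgK i).
Let KV i := subgroupV (sgK i).

Let HMr h g : H h -> H (g * h) <-> H g.
Proof.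
by move=> Hh; split=> [/HM/(_ (HV Hh))|/HM/(_ Hh)//]; rewrite mulgK.
Qed.

Definition same_dcoset i g u := exists2 k, K i k & H (u * k * g^-1).

(** The unique [k] in [K i] with [H u k = H g]: by [freeK], [K i] acts freely on the cosets of [H].
    The default 1 occurs only if [g] and [u] lie in different double cosets. *)
Definition dcoset_coord i g u :=
  classical_sets.xget 1 (fun k => K i k /\ H (u * k * g^-1)).

Lemma dcoset_coordE i g u k :
  K i k -> H (u * k * g^-1) -> dcoset_coord i g u = k.
Proof.
move=> Kk Hk; rewrite /dcoset_coord.
case: classical_sets.xgetP => [k' _ [Kk' Hk']|/(_ k)].
  apply: divg1_eq; apply: (freeK (i := i) (g := u)); first exact: KM (KV _).
  by have := HM Hk' (HV Hk); rewrite !invMg invgK !mulgA mulgVK.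
by case.
Qed.

Lemma dcoset_coordP i g u : same_dcoset i g u ->
  K i (dcoset_coord i g u) /\ H (u * dcoset_coord i g u * g^-1).
Proof. by case=> k Kk Hk; rewrite (dcoset_coordE Kk Hk). Qed.

Lemma dcoset_coordH i h g u : H h -> dcoset_coord i (h * g) u = dcoset_coord i g u.
Proof.
(* Equal predicates give equal choices, so the coordinate depends only on the coset [H g]. *)
move=> Hh; congr classical_sets.xget; apply: funext => k; apply: propext.
by rewrite invMg mulgA HMr //; apply: HV.
Qed.

Lemma same_dcosetH i h g : H h -> same_dcoset i (h * g) = same_dcoset i g.
Proof.
move=> Hh; apply: funext => u; apply: propext.
by split=> -[k Kk Hk]; exists k => //; move: Hk; rewrite invMg mulgA;
   rewrite (HMr _ (HV Hh)).
Qed.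

Lemma same_dcosetK i k g : K i k -> same_dcoset i (g * k) = same_dcoset i g.
Proof.
move=> Kk; apply: funext => u; apply: propext; split=> -[k' Kk' Hk'].
  exists (k' * k^-1); first exact: KM (KV _).
  by move: Hk'; rewrite invMg !mulgA.
by exists (k' * k); rewrite ?invMg ?mulgA ?mulgK //; apply: KM.
Qed.

Lemma dcoset_coordK i k g u : K i k -> same_dcoset i g u ->
  dcoset_coord i (g * k) u = dcoset_coord i g u * k.
Proof.
move=> Kk /dcoset_coordP[Kc Hc]; apply: dcoset_coordE; first exact: KM.
by rewrite invMg !mulgA mulgK.
Qed.

Definition near_dcoset (V : G -> option G) i g u := V u /\ same_dcoset i g u.

(* The value at [g] of the transversal for the double coset [H g (K i)],
   provided this double coset is within distance [n] of [H (K false)] in the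
   quotient of the Bass-Serre tree by [H]. *)
Fixpoint transversal n i g : option G :=
  if n isn't n'.+1 then
    if ~~ i && `[< same_dcoset i g 1 >] then Some (dcoset_coord i g 1) else None
  else if transversal n' i g is Some y then Some y
  else
    let P := near_dcoset (transversal n' (~~ i)) i g in
    let u := classical_sets.xget 1 P in
    if `[< exists u, P u >] then
      omap (fun y => y * dcoset_coord i g u) (transversal n' (~~ i) u)
    else None.

Lemma transversalH n i h g : H h -> transversal n i (h * g) = transversal n i g.
Proof.
move=> Hh; elim: n i => [|n IHn] i /=.
  by rewrite same_dcosetH ?dcoset_coordH.
by rewrite IHn dcoset_coordH // /near_dcoset same_dcosetH.
Qed.

(** The point of attachment [u] is chosen from a predicate on the double coset of [g], so it is the
    same for [g * k]; only the coordinate relative to [u] changes. *)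
Lemma transversalK n i k g : K i k ->
  transversal n i (g * k) = omap (fun y => y * k) (transversal n i g).
Proof.
move=> Kk; elim: n i Kk => [|n IHn] i Kk /=.
  rewrite same_dcosetK //; case: i Kk => //= Kk; case: asboolP => //= gP.
  by rewrite dcoset_coordK.
rewrite IHn //; case: (transversal n i g) => //=.
rewrite /near_dcoset same_dcosetK //.
case: asboolP => //= /(classical_sets.xgetPex 1).
move=> [_ uP]; rewrite dcoset_coordK //.
by case: (transversal _ _ _) => //= y; rewrite mulgA.
Qed.

Lemma transversalP n i g y : transversal n i g = Some y -> H (y * g^-1).
Proof.
elim: n i g y => [|n IHn] i g y /=.
  by case: ifP => // /andP[_ /asboolP/dcoset_coordP[_]] Hc [<-];
  rewrite -[dcoset_coord _ _ _]mul1g.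
case Dy: transversal => [y'|]; first by move=> [<-]; apply: IHn Dy.
case: asboolP => // /(classical_sets.xgetPex 1)[Vu /dcoset_coordP[_ Hc]].
case Dz: transversal => [z|] //= [<-]; have := HM (IHn _ _ _ Dz) Hc.
by rewrite !mulgA mulgVK.
Qed.

Lemma transversalD n m i g y :
  transversal n i g = Some y -> transversal (m + n) i g = Some y.
Proof. by move=> Dy; elim: m => //= m ->. Qed.

(** The quotient graph is connected because the factors generate [G]: from [g] to [g * k] with [k]
    in [K j], the double coset on side [j] is unchanged, and the one on the other side is adjacent
    to it through [g * k]. *)
Lemma transversal_total g i : exists n, transversal n i g.
Proof.
elim/genK: g i => [|g k j IHg Kk] i.
  have T0 : transversal 0 false 1.
    rewrite /= ifT //; apply/asboolP; exists 1; first exact: subgroup1 (sgK _).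
    by rewrite !mul1g invg1; apply: subgroup1.
  case: i; last by exists 0.
  exists 1%N => /=; case: asboolP => [/(classical_sets.xgetPex 1)[]|[]].
    by case: ifP.
  exists 1; split=> //; exists 1; first exact: subgroup1 (sgK _).
  by rewrite !mul1g invg1; apply: subgroup1.
have Tj : exists n, transversal n j (g * k).
  have [n Tn] := IHg j; exists n.
  by rewrite transversalK //; case: (transversal n j g) Tn.
have [->//|neq_ij] := eqVneq i j; have [n Tn] := Tj; exists n.+1 => /=.
have Dj : j = ~~ i by case: i j neq_ij {Tj Tn Kk} => [] [].
case: (transversal n i _) => //; rewrite -Dj.
case: asboolP => [/(classical_sets.xgetPex 1)[]|[]]; first by case: transversal.
exists (g * k); split=> //; exists 1; first exact: subgroup1 (sgK _).
by rewrite mulg1 mulgV; apply: subgroup1.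
Qed.

(** This is a maximal tree of the quotient graph, in terms of elements. The last clause is induction
    along it: a value on side [i] comes from a point [u] where both sides agree, moved by an element
    of [K i]. *)
Lemma tree_transversal : exists t : bool -> G -> G,
  [/\ forall i g, H (t i g * g^-1),
      forall i h g, H h -> t i (h * g) = t i g,
      forall i g k, K i k -> t i (g * k) = t i g * k,
      t false 1 = 1 &
      forall P : bool -> G -> Prop, (forall k, K false k -> P false k) ->
        (forall i u k, t i u = t (~~ i) u -> P (~~ i) (t (~~ i) u) -> K i k ->
           P i (t i u * k)) ->
      forall i g, P i (t i g)].
Proof.
have /choice[N NP] (ig : bool * G) : exists n, transversal n ig.1 ig.2.
  exact: transversal_total.
(* The stage is chosen separately for each [g], without harm: by [transversalD] a value persists at
   all later stages. *)
pose t i g := odflt 1 (transversal (N (i, g)) i g).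
have tE n i g y : transversal n i g = Some y -> t i g = y.
  move=> Dy; have := NP (i, g); rewrite /t /=.
  case Dz: transversal => [z|] // _; move/(transversalD n): Dz.
  by rewrite addnC (transversalD _ Dy) => -[].
have tP i g : exists n, transversal n i g = Some (t i g).
  by exists (N (i, g)); have := NP (i, g); rewrite /t /=; case: transversal.
exists t; split.
- by move=> i g; have [n] := tP i g; apply: transversalP.
- by move=> i h g Hh; have [n Dn] := tP i g; apply: (tE n); rewrite transversalH.
- move=> i g k Kk; have [n Dn] := tP i g; apply: (tE n).
  by rewrite transversalK // Dn.
- apply: (tE 0) => /=; have H1: H (1 * 1 * 1^-1).
    by rewrite !mul1g invg1; apply: subgroup1.
  have K1 := subgroup1 (sgK false).
  rewrite ifT; last by apply/asboolP; exists 1.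
  by rewrite (dcoset_coordE K1 H1).
- move=> P P0 PS i g; have [n] := tP i g; elim: n i g (t i g) => [|n IHn] i g y.
    rewrite /=; case: ifP => // /andP[/negbTE-> /asboolP/dcoset_coordP[Kc _]].
    by move=> [<-]; apply: P0.
  move=> Dy; move: (Dy) => /=; case Dz: transversal => [z|].
    by move=> [<-]; apply: IHn Dz.
  case: asboolP => // /(classical_sets.xgetPex 1).
  set u := classical_sets.xget 1 _ => -[_ /dcoset_coordP].
  set c := dcoset_coord _ _ _ => -[Kc Hc].
  case Dv: transversal => [v|] //= [Dvc].
  have Dg : transversal n.+1 i g = transversal n.+1 i (u * c).
    by rewrite -[in RHS](mulgVK g (u * c)) transversalH.
  have tu : t i u = v.
    apply: (tE n.+1); move: Dg; rewrite Dy transversalK // -Dvc.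
    by case: (transversal n.+1 i u) => //= w [/mulIg->].
  rewrite -Dvc -tu; apply: PS => //; first by rewrite tu (tE _ _ _ _ Dv).
  by rewrite (tE _ _ _ _ Dv); apply: IHn Dv.
Qed.

End TreeTransversal.

Lemma sval_inj T (P : T -> Prop) : injective (@sval T P).
Proof. by apply: eq_sig_hprop => y p q; apply: Prop_irrelevance. Qed.

(** * Subgroups meeting no conjugate of a factor *)

Section Cocycle.
Variables (X1 X2 S : Type) (G : groupType) (e : X1 + X2 -> G) (x : G -> word S).
Variable (Q : word S -> Prop).

Notation letter l := (if l%g.2 then (e l%g.1)^-1 else e l%g.1).

(** Reading [w] from [g], a letter of the first factor contributes nothing, and one of the second
    contributes the coboundary of [x]. Both rules agree on common elements of the factors when [x]
    is invariant under these, which is [xA]. *)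
Fixpoint cocycle (g : G) (w : word (X1 + X2)) : word S :=
  if w isn't l :: w' then [::]
  else (if l.1 is inr _ then word_inv (x g) ++ x (g * letter l) else [::])
         ++ cocycle (g * letter l) w'.

Lemma cocycle_cat g u v :
  cocycle g (u ++ v) = cocycle g u ++ cocycle (g * word_val e u) v.
Proof.
elim: u g => [|l u IHu] g; first by rewrite word_val_nil mulg1.
by rewrite /= IHu word_val_cons mulgA catA.
Qed.

Lemma cocycle_inl g u : cocycle g (word_map inl u) = [::].
Proof. by elim: u g => //= l u IHu g; rewrite IHu. Qed.

Lemma cocycle_inr g u : word_eq Q (cocycle g (word_map inr u))
  (word_inv (x g) ++ x (g * word_val e (word_map inr u))).
Proof.
elim: u g => [|l u IHu] g.
  by rewrite word_val_nil mulg1; apply/word_eq_sym/word_eq_Vmul.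
rewrite /= word_val_cons /= mulgA.
apply: word_eq_trans (word_eq_cat (word_eq_refl Q _) (IHu _)) _; rewrite -catA.
apply: word_eq_cat (word_eq_refl _ _) _; rewrite catA.
exact: word_eq_cat (word_eq_mulV Q _) (word_eq_refl _ _).
Qed.

Variable R : word (X1 + X2) -> Prop.
Hypothesis Rform : forall r, R r ->
  exists u v, r = word_map inl u ++ word_map inr v.
Hypothesis R1 : forall r, R r -> word_val e r = 1.
Hypothesis xA : forall g u v, word_val e (word_map inl u) =
  word_val e (word_map inr v) -> x (g * word_val e (word_map inl u)) = x g.

(** By [Rform] a relator is a word of the first factor followed by one of the second, so the values
    of both parts lie in both factors. There [x] is invariant, and the contribution of the relator
    cancels. *)
Lemma cocycle_eq g u v :
  word_eq R u v -> word_eq Q (cocycle g u) (cocycle g v).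
Proof.
have del u' r v' : word_val e r = 1 ->
    (forall h, word_eq Q (cocycle h r) [::]) ->
    word_eq Q (cocycle g (u' ++ r ++ v')) (cocycle g (u' ++ v')).
  move=> r1 cr; rewrite !cocycle_cat r1 mulg1.
  exact: word_eq_cat (word_eq_refl _ _) (word_eq_cat (cr _) (word_eq_refl _ _)).
elim=> [w|w w' _|w w' w'' _ IH1 _ IH2|u' y b v'|u' r v' Rr].
- exact: word_eq_refl.
- exact: word_eq_sym.
- exact: word_eq_trans IH1 IH2.
- apply: del => [|h].
    rewrite !word_val_cons word_val_nil mulg1 /=.
    by case: b; rewrite /= ?mulgV ?mulVg.
  case: y => [y|y]; first exact: (word_eq_refl _ [::]).
  have := cocycle_inr h [:: (y, b); (y, ~~ b)].
  rewrite !word_val_cons word_val_nil mulg1 /=.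
  move/word_eq_trans; apply; case: b; rewrite /= ?mulgV ?mulVg mulg1;
  exact: word_eq_Vmul.
- apply: del => [|h]; first exact: R1.
  have r1 := R1 Rr; have [s [t Dr]] := Rform Rr; move: r1; rewrite Dr.
  rewrite word_val_cat => st1; rewrite cocycle_cat cocycle_inl.
  apply: word_eq_trans (cocycle_inr _ _) _.
  rewrite (@xA _ s (word_inv t)); last first.
    rewrite -word_inv_map word_val_inv -[LHS](mulgK (word_val e (word_map inr t))).
    by rewrite st1 mul1g.
  by rewrite -mulgA st1 mulg1; apply: word_eq_Vmul.
Qed.

End Cocycle.

(* The elements [b g = t true g * (t false g)^-1] other than 1, where [t] is the
   transversal above, form a basis of [H]: the cocycle sends [g] in [H] to the
   unique word in this basis with value [g]. *)
Section FreeSubgroup.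
Variables (X1 X2 : Type) (G : groupType) (e : X1 + X2 -> G).
Variable R : word (X1 + X2) -> Prop.
Hypothesis presG : presents (fun _ : G => True) e R.
Hypothesis Rform : forall r, R r ->
  exists u v, r = word_map inl u ++ word_map inr v.
Variable H : G -> Prop.
Hypothesis sgH : is_subgroup H.
Hypothesis free1 : forall g u, H (g * word_val e (word_map inl u) * g^-1) ->
  word_val e (word_map inl u) = 1.
Hypothesis free2 : forall g u, H (g * word_val e (word_map inr u) * g^-1) ->
  word_val e (word_map inr u) = 1.

Let K (i : bool) : G -> Prop :=
  if i then generated_by (e \o inr) else generated_by (e \o inl).

Theorem is_free_trivial_meet : is_free H.
Proof.
have HM := subgroupM sgH; have HV := subgroupV sgH.
have sgK i : is_subgroup (K i) by case: i; apply: generated_subgroup.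
have [|i g k|t [tP tH tK t1 tind]] := tree_transversal sgH sgK.
- move=> P P1 PM g; have [w <-] := (presG.1 g).1 I.
  elim/last_ind: w => [|w [y b] IHw]; first by rewrite word_val_nil.
  rewrite -cats1 word_val_cat word_val_cons word_val_nil mulg1 /=.
  have Ky : exists i, K i (e y).
    by case: y => y; [exists false | exists true];
       apply: (generated_gen (e \o _)).
  by have [i Ki] := Ky; apply: (PM _ _ i) => //; case: b => //; apply: subgroupV.
- case: i => -[u <-]; rewrite -word_val_map; [exact: free2 | exact: free1].
(* Both transversals pick an element of [H g], so [b g] lies in [H]; it is 1 exactly where they
   agree, in particular along the maximal tree. *)
pose b g := t true g * (t false g)^-1.
pose S := {h : G | h <> 1 /\ exists g, h = b g}.
have bH g : H (b g).
  have := HM _ _ (tP true g) (HV _ (tP false g)).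
  by rewrite invMg invgK mulgA mulgVK.
(* A letter is determined by the value [b g], so cosets with equal values share a letter, and the
   value 1 gives the empty word. *)
pose x g : word S := if pselect (b g <> 1) is left bn1 then
  [:: (exist _ (b g) (conj bn1 (ex_intro _ g erefl)), false)] else [::].
have xb g g' : b g = b g' -> x g = x g'.
  rewrite /x => bgg'; case: pselect => [n1|n1]; case: pselect => [n2|n2] //.
  - by congr [:: (_, _)]; apply: sval_inj.
  - by case: n2; rewrite -bgg'.
  - by case: n1; rewrite bgg'.
have x_val g : word_val (@sval _ _) (x g) = b g.
  rewrite /x; case: pselect => [n1|/contrapT->]; last by rewrite word_val_nil.
  by rewrite word_val_cons word_val_nil mulg1.
have xH h g : H h -> x (h * g) = x g by move=> Hh; apply: xb; rewrite /b !tH.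
have xA g u v : word_val e (word_map inl u) = word_val e (word_map inr v) ->
    x (g * word_val e (word_map inl u)) = x g.
  move=> uv; apply: xb; rewrite /b [in t true _]uv !tK ?invMg ?mulgA.
  - by rewrite -uv mulgK.
  - by exists u; rewrite -word_val_map.
  - by exists v; rewrite -word_val_map.
have R1 r : R r -> word_val e r = 1.
  move=> Rr; rewrite -(word_val_nil e); apply/presG.2.
  exact: word_eq_relator1.
pose c := cocycle e x.
have cH h g w : H h -> c (h * g) w = c g w.
  rewrite /c; elim: w g => //= -[[y|y] b'] w IHw g Hh; rewrite -mulgA IHw //.
  by rewrite !(xH h).
have /choice[wd wdE] : forall g, exists w, word_val e w = g.
  by move=> g; apply: (presG.1 g).1.
(* The choice of [wd g] is immaterial up to free equality, since the cocycle respects the relators.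
   Invariance of [c] under [H] then makes [C] multiplicative when the left factor is in [H]. *)
pose C g := c 1 (wd g); pose F := fun _ : word S => False.
have CE w : word_eq F (C (word_val e w)) (c 1 w).
  apply: (cocycle_eq F Rform R1 xA); apply/presG.2; exact: wdE.
have C1 : word_eq F (C 1) [::] by have := CE [::]; rewrite word_val_nil.
have CM g w : word_eq F (C (g * word_val e w)) (C g ++ c g w).
  have := CE (wd g ++ w); rewrite word_val_cat wdE /c cocycle_cat.
  by rewrite wdE mul1g.
have CH h g : H h -> word_eq F (C (h * g)) (C h ++ C g).
  move=> Hh; have := CM h (wd g); rewrite wdE.
  by rewrite -[c h _](cH h^-1) ?mulVg //; apply: HV.
(* Induction along the maximal tree. Where both sides agree [x] is empty; from there, a step in the
   first factor contributes nothing and a step in the second contributes [x] at its end point. *)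
have Ct i g : word_eq F (C (t i g)) (if i then x (t i g) else [::]).
  pose P i g := word_eq F (C g) (if i then x g else [::]).
  apply: (tind P) => [k [u <-]|{}i u k tu Pu].
    rewrite /P -word_val_map; have := CE (word_map inl u).
    by rewrite /c cocycle_inl.
  have xu : x (t (~~ i) u) = [::].
    have Hu := tP (~~ i) u; rewrite -[t _ u](mulgVK u) xH //.
    rewrite /x; case: pselect => // -[]; rewrite /b.
    by case: (i) tu => /= ->; rewrite mulgV.
  rewrite /P in Pu *; rewrite tu; case: i tu xu Pu => /= tu xu Pu [v <-].
    rewrite -word_val_map; apply: word_eq_trans (CM _ _) _.
    apply: word_eq_trans (word_eq_cat Pu (cocycle_inr e x F _ _)) _.
    by rewrite xu; apply: word_eq_refl.
  rewrite -word_val_map; apply: word_eq_trans (CM _ _) _.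
  apply: word_eq_trans (word_eq_cat Pu (word_eq_refl _ _)) _.
  by rewrite xu /c cocycle_inl; apply: word_eq_refl.
have Cb g : word_eq F (C (b g)) (x g).
  have := CH _ (t false g) (bH g); rewrite /b mulgVK => /word_eq_sym.
  have eqC := word_eq_cat (word_eq_refl F (C (b g))) (Ct false g).
  rewrite cats0 in eqC => /(word_eq_trans (word_eq_sym eqC)).
  move/word_eq_trans; apply; apply: word_eq_trans (Ct true g) _.
  rewrite -(xH _ g (tP true g)) mulgVK; exact: word_eq_refl.
have SH (s : word S) : H (word_val (@sval _ _) s).
  elim: s => [|[[h hP] b'] s IHs]; first by rewrite word_val_nil; apply: subgroup1.
  rewrite word_val_cons; apply: HM => //=.
  by case: (hP) => _ [g Dh]; rewrite Dh; case: b' => //; apply: HV.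
(* [C] is a left inverse of evaluation up to free equality, which gives the absence of relations. *)
have CS (s : word S) : word_eq F (C (word_val (@sval _ _) s)) s.
  have letterP (y : S) : word_eq F (C (sval y)) [:: (y, false)].
    case: (svalP y) => n1 [g Dy]; rewrite Dy; apply: word_eq_trans (Cb g) _.
    rewrite /x; case: pselect => [n2|[]]; last by rewrite -Dy.
    rewrite [X in word_eq _ X](_ : _ = [:: (y, false)]); first exact: word_eq_refl.
    by congr [:: (_, _)]; apply: sval_inj; rewrite Dy.
  elim: s => [|[y b'] s IHs]; first by rewrite word_val_nil.
  have Hy : H (sval y).
    by have := SH [:: (y, false)]; rewrite word_val_cons word_val_nil mulg1.
  rewrite word_val_cons -cat1s; apply: word_eq_trans (CH _ _ _) _.
    by case: b' => //; apply: HV.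
  apply: word_eq_cat IHs; case: b' => //=.
  apply: (word_eq_invl (v := [:: (y, false)])).
  apply: word_eq_trans (word_eq_cat (word_eq_refl _ _) (word_eq_sym (letterP y))) _.
  have := CH _ (sval y) (HV _ Hy); rewrite mulVg => /word_eq_sym/word_eq_trans.
  exact.
exists S, (@sval _ _); split=> [g|u v]; last first.
  split; last exact: word_eq_val.
  move=> uv; apply: word_eq_trans (word_eq_sym (CS u)) _; rewrite uv; exact: CS.
split=> [Hg|[w <-]]; last exact: SH.
(* The contributions telescope along [w]. For [h = 1] and a value in [H], both transversal terms are
   1, so the element is the value of its cocycle. *)
have t_val w h : t false h * word_val e w * (t false (h * word_val e w))^-1 =
    word_val (@sval _ _) (c h w).
  elim: w h => [|[y b'] w IHw] h; first by rewrite !word_val_nil !mulg1 mulgV.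
  rewrite word_val_cons /c /= -/c word_val_cat -IHw !mulgA.
  set k := if b' then _ else _; congr (_ * _ * _).
  have {}Kk : K (if y is inr _ then true else false) k.
    rewrite /k; case: (y) => y'.
      case: (b'); [apply: subgroupV (sgK false) _ _|];
        exact: (generated_gen (e \o _)).
    case: (b'); [apply: subgroupV (sgK true) _ _|];
      exact: (generated_gen (e \o _)).
  case: (y) Kk => y' Kk; first by rewrite word_val_nil tK // mul1g.
  rewrite word_val_cat word_val_inv !x_val /b tK // !invMg !invgK !mulgA.
  by rewrite mulgVK mulgVK.
exists (c 1 (wd g)); rewrite -t_val wdE t1 !mul1g.
have -> : t false g = 1 by rewrite -[g]mulg1 tH // t1.
by rewrite invg1 mulg1.
Qed.
End FreeSubgroup.

(** * Free groups are torsion-free *)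

Section FreeReduction.
Variable X : eqType.
Implicit Types (l m : X * bool) (w u v : word X).

Definition letter_inv l : X * bool := (l.1, ~~ l.2).
Definition no_cancel l m := m != letter_inv l.

Lemma letter_invK : involutive letter_inv.
Proof. by case=> y b; rewrite /letter_inv /= negbK. Qed.

Definition push l w :=
  if w is m :: w' then if m == letter_inv l then w' else l :: w else [:: l].

Definition reduce w := foldr push [::] w.

Lemma push_reduced l w : sorted no_cancel w -> sorted no_cancel (push l w).
Proof.
case: w => //= m w mw; case: ifPn => [_|]; first exact: path_sorted mw.
by move=> lm /=; rewrite mw andbT.
Qed.

Lemma reduce_reduced w : sorted no_cancel (reduce w).
Proof. by elim: w => //= l w; apply: push_reduced. Qed.

Lemma reduce_id w : sorted no_cancel w -> reduce w = w.
Proof.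
elim: w => //= l w IHw lw; rewrite IHw ?(path_sorted lw) //.
by case: w lw {IHw} => //= m w /andP[/negbTE->].
Qed.

(** Van der Waerden's argument: letters act on reduced words, a letter and its inverse by mutually
    inverse maps, so [reduce] is invariant under free equality. *)
Lemma pushK l w : sorted no_cancel w -> push l (push (letter_inv l) w) = w.
Proof.
case: w => [|m w] /=; first by rewrite eqxx.
rewrite letter_invK; case: eqP => [->|_ _]; last by rewrite /= eqxx.
by case: w => //= m' w /andP[/negbTE->].
Qed.

Lemma reduce_eq u v : word_eq (fun _ => False) u v -> reduce u = reduce v.
Proof.
elim=> [//|//|w w' w'' _ -> _ //|u' y b v'|//].
rewrite /reduce !foldr_cat /= -/(reduce v'); congr foldr.
exact: (pushK (y, b) (reduce_reduced v')).
Qed.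

Lemma not_reduced w : ~~ sorted no_cancel w ->
  exists u l v, w = u ++ [:: l; letter_inv l] ++ v.
Proof.
elim: w => //= l [//|m w] IHw /=; rewrite negb_and negbK.
case/orP=> [/eqP->|/IHw[u [l' [v ->]]]]; first by exists [::], l, w.
by exists (l :: u), l', v.
Qed.

Lemma reduced_power n l w : path no_cancel l w -> no_cancel (last l w) l ->
  sorted no_cancel (flatten (nseq n (l :: w))).
Proof.
move=> lw wl; suff: path no_cancel (last l w) (flatten (nseq n (l :: w))).
  exact: path_sorted.
by elim: n => //= n IHn; rewrite wl cat_path lw.
Qed.

End FreeReduction.

Lemma word_val_power (G : groupType) X (e : X -> G) w n :
  word_val e (flatten (nseq n w)) = word_val e w ^+ n.
Proof.
elim: n => [|n IHn] /=; first by rewrite word_val_nil.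
by rewrite word_val_cat IHn expgS.
Qed.

(** Induction on the length: delete a cancelling pair, or conjugate away a first letter inverse to
    the last. A nonempty word allowing neither is cyclically reduced, so its positive powers are
    reduced and nonempty. *)
Lemma free_basis_torsion_free (G : groupType) (X : eqType) (e : X -> G) w n :
  (forall u v, word_val e u = word_val e v -> word_eq (fun _ => False) u v) ->
  word_val e w ^+ n.+1 = 1 -> word_val e w = 1.
Proof.
move=> freeE; have [k] := ubnP (size w); elim: k w => // k IHk w sz_w wn1.
have [red_w|/not_reduced[u [[y b] [v Dw]]]] := boolP (sorted (@no_cancel X) w).
  case: w => [|l w] /= in sz_w wn1 red_w *; first by rewrite word_val_nil.
  have [wl|] := boolP (no_cancel (last l w) l).
    have := reduced_power n.+1 red_w wl => /reduce_id.
    rewrite (@reduce_eq _ _ [::]) //; apply: freeE.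
    by rewrite word_val_power word_val_nil.
  (* A letter is not its own inverse, so ends that cancel are two distinct positions. *)
  rewrite negbK; case/lastP: w => [|w m] in sz_w wn1 red_w *.
    by case: l red_w sz_w wn1 => y [] _ _ _ /eqP; rewrite /letter_inv /=; case.
  rewrite last_rcons => /eqP Dl; rewrite size_rcons in sz_w.
  have Dw : word_val e (l :: rcons w m) = word_val e w ^ word_val e [:: m].
    rewrite -cats1 -cat1s !word_val_cat Dl; congr (_ * _).
    rewrite !word_val_cons !word_val_nil !mulg1 /=.
    by case: (m) => y [] /=; rewrite ?invgK.
  rewrite Dw (IHk w) ?conj1g //; first exact: ltn_trans (ltnSn _) _.
  by apply: (conjg_inj (word_val e [:: m])); rewrite conjXg -Dw wn1 conj1g.
have Euv : word_val e w = word_val e (u ++ v).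
  by rewrite Dw; apply: word_eq_val (word_eq_cancel (fun _ => False) _ _ _ _).
rewrite Euv; apply: IHk; last by rewrite -Euv.
by move: sz_w; rewrite Dw !size_cat /= !addnS !ltnS; apply: leq_trans (leqnSn _).
Qed.

Lemma is_free_torsion_free (G : groupType) (H : G -> Prop) h n :
  is_free H -> H h -> h ^+ n.+1 = 1 -> h = 1.
Proof.
case=> S [b [Hgen Hfree]] /Hgen[w <-].
by apply: (@free_basis_torsion_free _ {classic S} b) => u v /Hfree.
Qed.

(** * Free actions of finite groups *)

(** The map is total but constrained only on [B], so that partial actions on several parts of one
    set share an ambient type. *)
Record free_act (K : finGroupType) (T : finType) (B : {set T})
    (f : T -> K -> T) : Prop := FreeAct {
  free_act_in : forall x a, x \in B -> f x a \in B;
  free_act1 : forall x, x \in B -> f x 1 = x;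
  free_actM : forall x a b, x \in B -> f (f x a) b = f x (a * b);
  free_act_free : forall x a, x \in B -> f x a = x -> a = 1 }.

Section FreeActTheory.
Variables (K : finGroupType) (T : finType) (B : {set T}) (f : T -> K -> T).
Hypothesis fB : free_act B f.

Lemma free_actK x a : x \in B -> f (f x a) a^-1 = x.
Proof. by move=> Bx; rewrite (free_actM fB) // mulgV (free_act1 fB). Qed.

Lemma free_act_inj x : x \in B -> injective (f x).
Proof.
move=> Bx a b fab; apply/esym/divg1_eq; apply: (free_act_free fB Bx).
by rewrite -(free_actM fB) // -fab free_actK.
Qed.

Lemma free_act_inE x a : x \in B -> forall C : {set T}, C \subset B ->
  (forall y b, y \in C -> f y b \in C) -> (f x a \in C) = (x \in C).
Proof.
move=> Bx C sCB fC; apply/idP/idP; last exact: fC.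
by move/(fC _ a^-1); rewrite free_actK.
Qed.

Lemma free_act_sub (C : {set T}) : C \subset B ->
  (forall x a, x \in C -> f x a \in C) -> free_act C f.
Proof.
move=> sCB fC; split=> // [x|x a b|x a] /(subsetP sCB).
- exact: free_act1 fB _.
- exact: free_actM fB _ _ _.
- exact: free_act_free fB _ _.
Qed.

Lemma free_act_setD (C : {set T}) : C \subset B ->
  (forall x a, x \in C -> f x a \in C) -> free_act (B :\: C) f.
Proof.
move=> sCB fC; apply: free_act_sub (subsetDl _ _) _ => x a /setDP[Bx nCx].
by rewrite inE (free_act_in fB) // free_act_inE // nCx.
Qed.

Definition act_orbit x := [set f x a | a in [set: K]].

Lemma act_orbit_sub x : x \in B -> act_orbit x \subset B.
Proof. by move=> Bx; apply/subsetP=> _ /imsetP[a _ ->]; apply: free_act_in. Qed.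

Lemma act_orbit_in x y a : x \in B -> y \in act_orbit x -> f y a \in act_orbit x.
Proof.
by move=> Bx /imsetP[b _ ->]; rewrite (free_actM fB) // imset_f // inE.
Qed.

Lemma card_act_orbit x : x \in B -> #|act_orbit x| = #|K|.
Proof.
by move=> Bx; rewrite card_imset ?cardsT //; apply: free_act_inj.
Qed.

Lemma free_act_setD_orbit x : x \in B -> free_act (B :\: act_orbit x) f.
Proof.
by move=> Bx; apply: free_act_setD (act_orbit_sub Bx) _ => y a; apply: act_orbit_in.
Qed.

Lemma card_setD_orbit x : x \in B -> #|B| = (#|K| + #|B :\: act_orbit x|)%N.
Proof.
by move=> Bx; rewrite -(cardsID (act_orbit x)) (setIidPr (act_orbit_sub Bx))
  card_act_orbit.
Qed.

End FreeActTheory.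

Lemma free_act_dvdn (K : finGroupType) (T : finType) (B : {set T})
  (f : T -> K -> T) : free_act B f -> #|K| %| #|B|.
Proof.
have [n] := ubnP #|B|; elim: n B => // n IHn B leB fB.
have [->|[x Bx]] := set_0Vmem B; first by rewrite cards0.
have cardB := card_setD_orbit fB Bx; rewrite cardB dvdn_addr //.
apply: IHn (free_act_setD_orbit fB Bx); rewrite -ltnS (leq_trans _ leB) //.
by rewrite ltnS cardB -[X in X < _]add0n ltn_add2r; apply/card_gt0P; exists 1.
Qed.

(** Free [K]-sets are disjoint unions of regular orbits, so only the cardinal matters; orbits are
    matched one at a time. [u0] is a default for the map outside [B]. *)
Lemma free_act_iso (K : finGroupType) (T U : finType) (B : {set T}) (E : {set U})
    (f : T -> K -> T) (g : U -> K -> U) (u0 : U) :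
  free_act B f -> free_act E g -> #|B| = #|E| ->
  exists h : T -> U, [/\ forall x, x \in B -> h x \in E, {in B &, injective h} &
    forall x a, x \in B -> h (f x a) = g (h x) a].
Proof.
have [n] := ubnP #|B|; elim: n B E => // n IHn B E leB fB gE eqBE.
have [B0|[x Bx]] := set_0Vmem B.
  by exists (fun _ => u0); rewrite B0; split=> [x|x y|x a]; rewrite inE.
have cardB := card_setD_orbit fB Bx.
have K_gt0 : 0 < #|K| by apply/card_gt0P; exists 1.
have [E0|[y Ey]] := set_0Vmem E.
  move: K_gt0; rewrite ltnNge (leq_trans (leq_addr #|B :\: act_orbit f x| _)) //.
  by rewrite -cardB eqBE E0 cards0.
have cardE := card_setD_orbit gE Ey.
have fB' := free_act_setD_orbit fB Bx; have gE' := free_act_setD_orbit gE Ey.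
have [||h [hE h_inj hf]] := IHn _ _ _ fB' gE'.
- by rewrite -ltnS (leq_trans _ leB) // ltnS cardB -[X in X < _]add0n ltn_add2r.
- by apply/eqP; rewrite -(eqn_add2l #|K|) -cardB -cardE eqBE.
pose h' z := if [pick a | f x a == z] is Some a then g y a else h z.
have h'O a : h' (f x a) = g y a.
  rewrite /h'; case: pickP => [b /eqP/(free_act_inj fB Bx)->//|/(_ a)].
  by rewrite eqxx.
have h'N z : z \notin act_orbit f x -> h' z = h z.
  rewrite /h'; case: pickP => // a /eqP <-.
  by rewrite imset_f ?inE.
have BP z : z \in B -> (exists a, z = f x a) \/
    (z \notin act_orbit f x /\ z \in B :\: act_orbit f x).
  move=> Bz; have [/imsetP[a _ ->]|nOz] := boolP (z \in act_orbit f x).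
    by left; exists a.
  by right; rewrite inE nOz.
have gN z a : z \in E :\: act_orbit g y -> z <> g y a.
  by move=> /setDP[_ nO] Dz; rewrite Dz imset_f ?inE in nO.
exists h'; split=> [z /BP|z t /BP zP /BP tP|z a /BP].
- case=> [[a ->]|[nO Bz]]; first by rewrite h'O (free_act_in gE).
  by rewrite h'N //; have /setDP[] := hE _ Bz.
- case: zP tP => [[a ->]|[nOz Bz]] [[b ->]|[nOt Bt]].
  + by rewrite !h'O => /(free_act_inj gE Ey)->.
  + by rewrite h'O h'N // => /esym/gN; case; apply: hE.
  + by rewrite h'O h'N // => /gN; case; apply: hE.
  + by rewrite !h'N //; apply: h_inj.
- case=> [[b ->]|[nOz Bz]].
    by rewrite (free_actM fB) // !h'O (free_actM gE).
  have Bz' := free_act_in fB' a Bz; rewrite !h'N ?hf //.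
  by case/setDP: Bz'.
Qed.

(** Since [D] is a union of free [K]-orbits, [#|K|] divides the cardinal of its complement. As an
    [A]-set the complement is then isomorphic to copies of [K], and the right translations of [K]
    are transported to it. *)
Lemma extend_free_act (A K : finGroupType) (phi : A -> K)
    (W : finType) (w0 : W) (D : {set W}) (f : W -> A -> W) (d : W -> K -> W) :
  {morph phi : a b / a * b} -> injective phi ->
  free_act [set: W] f -> free_act D d ->
  (forall x a, x \in D -> d x (phi a) = f x a) -> #|K| %| #|W| ->
  exists d', [/\ free_act [set: W] d', forall x a, d' x (phi a) = f x a &
    forall x k, x \in D -> d' x k = d x k].
Proof.
move=> phiM inj_phi fW dD df dvdW.
have phi1 : phi 1 = 1 by apply: (mulgI (phi 1)); rewrite -phiM !mulg1.
have fE : free_act (~: D) f.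
  rewrite -setTD; apply: (free_act_setD fW) (subsetT _) _ => x a Dx.
  by rewrite -df //; apply: free_act_in dD _ _ _.
have /dvdnP[q cardE] : #|K| %| #|~: D|.
  by rewrite -(dvdn_addr _ (free_act_dvdn dD)) cardsC.
pose g (t : 'I_q * K) a := (t.1, t.2 * phi a).
have gT : free_act [set: 'I_q * K] g.
  split=> // [[i k]|[i k] a b|[i k] a] _; rewrite /g /=.
  - by rewrite phi1 mulg1.
  - by rewrite phiM mulgA.
  - case=> /(canRL (mulKg _)); rewrite mulVg => Da.
    by apply: inj_phi; rewrite Da phi1.
have [|h [hE h_inj hf]] := free_act_iso w0 gT fE.
  by rewrite cardsT card_prod card_ord.
pose d' x k := if x \in D then d x k else
  if [pick t | h t == x] is Some t then h (t.1, t.2 * k) else x.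
have d'h t k : d' (h t) k = h (t.1, t.2 * k).
  have := hE t (in_setT _); rewrite /d' inE => /negbTE->.
  case: pickP => [s /eqP/h_inj->//|/(_ t)]; by rewrite ?inE ?eqxx.
have xP x : x \in D \/ exists t, x = h t.
  have [Dx|nDx] := boolP (x \in D); [by left|right].
  have hT : h @: [set: 'I_q * K] = ~: D.
    apply/eqP; rewrite eqEcard card_in_imset // cardsT card_prod card_ord cardE.
    by rewrite leqnn andbT; apply/subsetP=> _ /imsetP[t _ ->]; apply: hE.
  have: x \in ~: D by rewrite inE.
  by rewrite -hT => /imsetP[t _ ->]; exists t.
have d'D x k : x \in D -> d' x k = d x k by rewrite /d' => ->.
exists d'; split=> // [|x a]; last first.
  case: (xP x) => [Dx|[[i k] ->]]; first by rewrite d'D // df.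
  by rewrite d'h -hf ?inE.
split=> // [x _|x a b _|x a _].
- case: (xP x) => [Dx|[[i k] ->]]; first by rewrite d'D // (free_act1 dD).
  by rewrite d'h mulg1.
- case: (xP x) => [Dx|[[i k] ->]].
    by rewrite !d'D ?(free_actM dD) // (free_act_in dD).
  by rewrite !d'h /= mulgA.
- case: (xP x) => [Dx|[[i k] ->]].
    by rewrite d'D //; apply: (free_act_free dD).
  by rewrite d'h => /h_inj; rewrite !inE => /(_ isT isT)[/(canRL (mulKg _))];
     rewrite mulVg.
Qed.

(** * Finite certificates of freeness *)

Section WordAction.
Variables (X W : Type) (act : X * bool -> W -> W).

Definition word_act (p : W) (w : word X) : W := foldl (fun q l => act l q) p w.

Lemma word_act_cat p u v : word_act p (u ++ v) = word_act (word_act p u) v.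
Proof. exact: foldl_cat. Qed.

Lemma word_act_eq (R : word X -> Prop) u v p :
  (forall y b p, word_act p [:: (y, b); (y, ~~ b)] = p) ->
  (forall r p, R r -> word_act p r = p) ->
  word_eq R u v -> word_act p u = word_act p v.
Proof.
move=> actK actR uv; elim: uv p => [//|w w' _ IH p|w w' w'' _ IH1 _ IH2 p||].
- by rewrite IH.
- by rewrite IH1.
- by move=> u' y b v' p; rewrite !word_act_cat actK.
- by move=> u' r v' Rr p; rewrite !word_act_cat (actR r).
Qed.

End WordAction.

Lemma word_act_map (X Z W : Type) (f : X -> Z) (act : Z * bool -> W -> W) p w :
  word_act act p (word_map f w) = word_act (fun l => act (f l.1, l.2)) p w.
Proof. by elim: w p => /=. Qed.

Record certificate (X : eqType) (pos neg hs : seq (word X)) (W : Type)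
    (act : X * bool -> W -> W) (p0 : W) : Prop := Certificate {
  cert_pos : forall r p, r \in pos -> word_act act p r = p;
  cert_neg : forall r p, r \in neg -> word_act act p r <> p;
  cert_fix : forall h, h \in hs -> word_act act p0 h = p0 }.

Section Amalgam.
Variables (X1 X2 : finType) (R1 : seq (word X1)) (R2 : seq (word X2)).
Variables (G1 G2 : finGroupType) (e1 : X1 -> G1) (e2 : X2 -> G2).
Hypothesis presG1 : presents (fun _ : G1 => True) e1 (fun r => r \in R1).
Hypothesis presG2 : presents (fun _ : G2 => True) e2 (fun r => r \in R2).
Variables (A : finGroupType) (Y : {set A}).
Hypothesis genY : (<<Y>> = [set: A])%g.
Variables (phi1 : {multiplicative A -> G1}) (phi2 : {multiplicative A -> G2}).
Hypotheses (inj_phi1 : injective phi1) (inj_phi2 : injective phi2).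
Variables (G : groupType) (e : X1 + X2 -> G).
Hypothesis presG : presents (fun _ : G => True) e
  (amalgam_relator R1 R2 e1 e2 Y phi1 phi2).
Variables (s1 : G1 -> word X1) (s2 : G2 -> word X2).
Hypotheses (s1K : forall g, word_val e1 (s1 g) = g).
Hypotheses (s2K : forall g, word_val e2 (s2 g) = g).

(** A certificate assigns arbitrary maps to a letter and to its inverse, so cancelling pairs are
    listed. One pair of words for each [a] is enough for the identifications: the relators of the
    factors give the others. *)
Definition trivial_words : seq (word (X1 + X2)) :=
  [seq [:: (l.1, l.2); (l.1, ~~ l.2)] | l : (X1 + X2) * bool]
  ++ [seq word_map inl r | r <- R1] ++ [seq word_map inr r | r <- R2]
  ++ [seq word_map inl (s1 (phi1 a)) ++ word_inv (word_map inr (s2 (phi2 a)))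
     | a : A].

Definition nontrivial_words : seq (word (X1 + X2)) :=
  [seq word_map inl (s1 g) | g <- enum G1 & g != 1]
  ++ [seq word_map inr (s2 g) | g <- enum G2 & g != 1].

(* The action extends to [G], with [G1] and [G2] acting freely. *)
Notation amalgam_certificate := (certificate trivial_words nontrivial_words).

Lemma relator_val r : amalgam_relator R1 R2 e1 e2 Y phi1 phi2 r ->
  word_val e r = 1.
Proof.
move=> Rr; rewrite -(word_val_nil e); apply/presG.2.
exact: word_eq_relator1.
Qed.

Lemma inl_val u v : word_val e1 u = word_val e1 v ->
  word_val e (word_map inl u) = word_val e (word_map inl v).
Proof.
move/presG1.2; rewrite !word_val_map; apply: word_eq_val => r Rr.
by rewrite -word_val_map; apply/relator_val/amalgam_relator1.
Qed.

Lemma inr_val u v : word_val e2 u = word_val e2 v ->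
  word_val e (word_map inr u) = word_val e (word_map inr v).
Proof.
move/presG2.2; rewrite !word_val_map; apply: word_eq_val => r Rr.
by rewrite -word_val_map; apply/relator_val/amalgam_relator2.
Qed.

(** * From certificates to freeness *)

Section Soundness.
Variables (W : Type) (act : (X1 + X2) * bool -> W -> W).
Variables (hs : seq (word (X1 + X2))) (p0 : W).
Hypothesis cert : amalgam_certificate hs act p0.
Local Notation actw := (word_act act).

Let actK y b p : actw p [:: (y, b); (y, ~~ b)] = p.
Proof.
apply: (cert_pos cert); rewrite mem_cat; apply/orP; left.
by apply/mapP; exists (y, b); rewrite ?mem_enum.
Qed.

Lemma act_inl u v p : word_val e1 u = word_val e1 v ->
  actw p (word_map inl u) = actw p (word_map inl v).
Proof.
move=> /presG1.2 uv; rewrite !word_act_map.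
apply: word_act_eq uv => [y b q|r q Rr]; first exact: (actK (inl y)).
rewrite -(word_act_map inl act); apply: (cert_pos cert).
by rewrite !mem_cat map_f ?orbT.
Qed.

Lemma act_inr u v p : word_val e2 u = word_val e2 v ->
  actw p (word_map inr u) = actw p (word_map inr v).
Proof.
move=> /presG2.2 uv; rewrite !word_act_map.
apply: word_act_eq uv => [y b q|r q Rr]; first exact: (actK (inr y)).
rewrite -(word_act_map inr act); apply: (cert_pos cert).
by rewrite !mem_cat map_f ?orbT.
Qed.

Lemma act_val u v p : word_val e u = word_val e v -> actw p u = actw p v.
Proof.
move=> /presG.2; apply: word_act_eq => // _ {}p [r Rr|r Rr|a {}u {}v Ya Du Dv].
- by apply: (cert_pos cert); rewrite !mem_cat map_f ?orbT.
- by apply: (cert_pos cert); rewrite !mem_cat map_f ?orbT.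
have Ra : actw p (word_map inl (s1 (phi1 a)) ++
    word_inv (word_map inr (s2 (phi2 a)))) = p.
  apply: (cert_pos cert); rewrite !mem_cat; do 3!(apply/orP; right).
  by apply/mapP; exists a; rewrite ?mem_enum.
rewrite -[RHS]Ra !word_act_cat (act_inl (v := s1 (phi1 a))) ?s1K //.
by rewrite !word_inv_map; apply: act_inr; rewrite !word_val_inv s2K Dv.
Qed.

Let actV p w : actw (actw p w) (word_inv w) = p.
Proof.
rewrite -word_act_cat -[RHS]/(actw p [::]); apply: act_val.
by rewrite word_val_cat word_val_inv mulgV word_val_nil.
Qed.

Let H := generated_by (fun i : 'I_(size hs) => word_val e (nth [::] hs i)).

Lemma generated_fix w : H (word_val e w) -> actw p0 w = p0.
Proof.
pose F g := forall w, word_val e w = g -> actw p0 w = p0.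
suff: forall g, H g -> F g by move=> HF /HF; apply.
apply: generated_le => [|i w' Dw]; last first.
  by rewrite (act_val _ Dw); apply: (cert_fix cert); rewrite mem_nth.
have ex_w g : exists w, word_val e w = g by apply: (presG.1 g).1.
split=> [w'|x y Fx Fy w'|x Fx w'].
- by rewrite -(word_val_nil e) => /act_val->.
- have [u Du] := ex_w x; have [v Dv] := ex_w y.
  rewrite -Du -Dv -word_val_cat => /act_val->.
  by rewrite word_act_cat Fx // Fy.
- have [u Du] := ex_w x; rewrite -Du -word_val_inv => /act_val->.
  by rewrite -{1}(Fx u Du) actV.
Qed.

(** If [u w u^-1] fixes [p0], then [w] fixes the image of [p0] under [u]. *)
Lemma conj_fix g w : H (g * word_val e w * g^-1) ->
  exists q, actw q w = q.
Proof.
have [u <-] := (presG.1 g).1 I.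
rewrite -word_val_inv -!word_val_cat => /generated_fix.
rewrite !word_act_cat => p0E; exists (actw p0 u).
by have := actV (actw (actw p0 u) w) (word_inv u); rewrite word_invK p0E.
Qed.

Lemma certificate_free : is_free H.
Proof.
apply: (is_free_trivial_meet presG).
- move=> _ [r _|r _|a u v _ _ _].
  + by exists r, [::]; rewrite /= cats0.
  + by exists [::], r.
  + by exists u, (word_inv v); rewrite word_inv_map.
- exact: generated_subgroup.
- move=> g u /conj_fix[q uq]; have := @inl_val u [::].
  rewrite !word_val_nil; apply; apply/eqP/negPn/negP => nt_u.
  rewrite (act_inl (v := s1 (word_val e1 u))) ?s1K // in uq.
  apply: (cert_neg cert _ uq); rewrite mem_cat; apply/orP; left.
  by apply/mapP; exists (word_val e1 u) => //; rewrite mem_filter /= nt_u mem_enum.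
- move=> g u /conj_fix[q uq]; have := @inr_val u [::].
  rewrite !word_val_nil; apply; apply/eqP/negPn/negP => nt_u.
  rewrite (act_inr (v := s2 (word_val e2 u))) ?s2K // in uq.
  apply: (cert_neg cert _ uq); rewrite mem_cat; apply/orP; right.
  by apply/mapP; exists (word_val e2 u) => //; rewrite mem_filter /= nt_u mem_enum.
Qed.

End Soundness.

(** * Certificates from compatible free actions *)

Section FreeActions.
Variables (W : finType) (d1 : W -> G1 -> W) (d2 : W -> G2 -> W).
Hypotheses (fd1 : free_act [set: W] d1) (fd2 : free_act [set: W] d2).
Hypothesis d12 : forall x a, d1 x (phi1 a) = d2 x (phi2 a).

Definition amalgam_act (l : (X1 + X2) * bool) (x : W) : W :=
  match l.1 with
  | inl y => d1 x (if l.2 then (e1 y)^-1 else e1 y)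
  | inr y => d2 x (if l.2 then (e2 y)^-1 else e2 y)
  end.

Lemma amalgam_act_inl x u :
  word_act amalgam_act x (word_map inl u) = d1 x (word_val e1 u).
Proof.
elim: u x => [|l u IHu] x; first by rewrite word_val_nil (free_act1 fd1).
by rewrite word_val_cons -(free_actM fd1) -?IHu.
Qed.

Lemma amalgam_act_inr x u :
  word_act amalgam_act x (word_map inr u) = d2 x (word_val e2 u).
Proof.
elim: u x => [|l u IHu] x; first by rewrite word_val_nil (free_act1 fd2).
by rewrite word_val_cons -(free_actM fd2) -?IHu.
Qed.

Lemma amalgam_act_certificate hs p0 :
  (forall h, h \in hs -> word_act amalgam_act p0 h = p0) ->
  amalgam_certificate hs amalgam_act p0.
Proof.
split=> // r p; rewrite mem_cat.
  case/orP=> [/mapP[[[y|y] b] _ ->]|].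
  - rewrite /= /amalgam_act /= (free_actM fd1) //.
    by case: b => /=; rewrite ?mulgV ?mulVg (free_act1 fd1).
  - rewrite /= /amalgam_act /= (free_actM fd2) //.
    by case: b => /=; rewrite ?mulgV ?mulVg (free_act1 fd2).
  rewrite !mem_cat => /or3P[] /mapP[a aP ->].
  - rewrite amalgam_act_inl; have /presG1.2 : word_eq (fun r => r \in R1) a [::].
      exact: word_eq_relator1.
    by rewrite word_val_nil => ->; rewrite (free_act1 fd1).
  - rewrite amalgam_act_inr; have /presG2.2 : word_eq (fun r => r \in R2) a [::].
      exact: word_eq_relator1.
    by rewrite word_val_nil => ->; rewrite (free_act1 fd2).
  - rewrite word_act_cat word_inv_map amalgam_act_inl amalgam_act_inr.
    by rewrite word_val_inv s1K s2K d12 (free_actK fd2).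
case/orP=> /mapP[g]; rewrite mem_filter => /andP[/eqP nt_g _] ->.
- by rewrite amalgam_act_inl s1K => /(free_act_free fd1 (in_setT _))/nt_g.
- by rewrite amalgam_act_inr s2K => /(free_act_free fd2 (in_setT _))/nt_g.
Qed.

End FreeActions.

Lemma card_dvdn_inj (K L : finGroupType) (phi : {multiplicative K -> L}) :
  injective phi -> #|K| %| #|L|.
Proof.
move=> inj_phi; have phi_1 : phi 1 = 1.
  by apply: (mulgI (phi 1)); rewrite -gmulfM !mulg1.
rewrite -[#|L|]cardsT; apply: (@free_act_dvdn _ _ _ (fun x a => x * phi a)).
split=> // [x _|x a b _|x a _]; first by rewrite phi_1 mulg1.
  by rewrite gmulfM mulgA.
move/(canRL (mulKg _)); rewrite mulVg => pa1.
by apply: inj_phi; rewrite pa1 phi_1.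
Qed.

(** Padding by free [A]-orbits is possible because [#|A|] divides both [n] and [#|T|]. Each factor
    is then extended on its own, and the results are compatible since both restrict to the same
    action of [A]. *)
Lemma extend_free_acts (T : finType) (f : T -> A -> T) (D1 D2 : {set T})
    (d1 : T -> G1 -> T) (d2 : T -> G2 -> T) n :
  free_act [set: T] f -> free_act D1 d1 -> free_act D2 d2 ->
  (forall x a, x \in D1 -> d1 x (phi1 a) = f x a) ->
  (forall x a, x \in D2 -> d2 x (phi2 a) = f x a) ->
  #|G1| %| n -> #|G2| %| n -> #|T| <= n -> 0 < n ->
  exists (W : finType) (j : T -> W) (d1' : W -> G1 -> W) (d2' : W -> G2 -> W),
    [/\ #|W| = n, free_act [set: W] d1' /\ free_act [set: W] d2',
       forall x a, d1' x (phi1 a) = d2' x (phi2 a),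
       forall x k, x \in D1 -> d1' (j x) k = j (d1 x k) &
       forall x k, x \in D2 -> d2' (j x) k = j (d2 x k)].
Proof.
move=> fT fd1 fd2 d1f d2f dvd1 dvd2 leTn n_gt0.
have /dvdnP[m Dm] : #|A| %| n - #|T|.
  apply: dvdn_sub; first exact: dvdn_trans (card_dvdn_inj inj_phi1) dvd1.
  by have := free_act_dvdn fT; rewrite cardsT.
pose W := (T + 'I_m * A)%type; pose j : T -> W := inl.
have cardW : #|{: W}| = n by rewrite card_sum card_prod card_ord -Dm subnKC.
have w0 : W by apply: (enum_val (cast_ord (esym cardW) (Ordinal n_gt0))).
pose fW (x : W) a : W := match x with inl t => inl (f t a)
                                    | inr (i, b) => inr (i, b * a) end.
have fWP : free_act [set: W] fW.
  split=> // [[t|[i b]]|[t|[i b]] a c|[t|[i b]] a] _ /=.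
  - by rewrite (free_act1 fT).
  - by rewrite mulg1.
  - by rewrite (free_actM fT).
  - by rewrite mulgA.
  - by case=> /(free_act_free fT (in_setT _)).
  - by case=> /(canRL (mulKg _)); rewrite mulVg.
pose lift (K : finGroupType) (d : T -> K -> T) (x : W) k : W :=
  if x is inl t then inl (d t k) else x.
have liftP (K : finGroupType) (d : T -> K -> T) (D : {set T}) :
    free_act D d -> free_act (j @: D) (@lift K d).
  move=> fd; split=> [x a|x|x a b|x a] /imsetP[t Dt ->] /=.
  - by apply: imset_f; apply: free_act_in fd _ _ _.
  - by rewrite (free_act1 fd).
  - by rewrite (free_actM fd).
  - by case=> /(free_act_free fd Dt).
have ext (K : finGroupType) (phi : {multiplicative A -> K}) d D :
    injective phi -> free_act D d ->
    (forall x a, x \in D -> d x (phi a) = f x a) -> #|K| %| n ->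
  exists d', [/\ free_act [set: W] d', forall x a, d' x (phi a) = fW x a &
      forall x k, x \in D -> d' (j x) k = j (d x k)].
  move=> inj_phi fd df dvdn.
  have [||d' [fd' d'f d'j]] := extend_free_act w0 (@gmulfM _ _ phi) inj_phi fWP
    (liftP _ _ _ fd); last first.
  - exists d'; split=> // x k Dx; rewrite d'j //; exact: imset_f.
  - by rewrite cardW.
  - by move=> x a /imsetP[t Dt ->] /=; rewrite df.
have [d1' [fd1' d1'f d1'j]] := ext _ _ _ _ inj_phi1 fd1 d1f dvd1.
have [d2' [fd2' d2'f d2'j]] := ext _ _ _ _ inj_phi2 fd2 d2f dvd2.
exists W, j, d1', d2'; split=> // x a; by rewrite d1'f d2'f.
Qed.

(** * Embedding of the factors in the amalgam *)

Let i1 g := word_val e (word_map inl (s1 g)).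
Let i2 g := word_val e (word_map inr (s2 g)).

Let i1M : {morph i1 : x y / x * y}.
Proof.
move=> x y; rewrite /i1 -word_val_cat -map_cat.
by apply: inl_val; rewrite word_val_cat !s1K.
Qed.

Let i2M : {morph i2 : x y / x * y}.
Proof.
move=> x y; rewrite /i2 -word_val_cat -map_cat.
by apply: inr_val; rewrite word_val_cat !s2K.
Qed.

(** The presentation identifies the images of [Y] only; in a finite group every element is a product
    of generators. *)
Let i12 a : i1 (phi1 a) = i2 (phi2 a).
Proof.
have: a \in <<Y>> by rewrite genY inE.
case/gen_prodgP=> n [c cY ->]; elim: n c cY => [|n IHn] c cY.
  rewrite !big_ord0 /i1 /i2 (inl_val (v := [::])) ?(inr_val (v := [::])) //.
    rewrite s2K word_val_nil; apply: (mulgI (phi2 1)).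
    by rewrite -gmulfM !mulg1.
  rewrite s1K word_val_nil; apply: (mulgI (phi1 1)).
  by rewrite -gmulfM !mulg1.
rewrite big_ord_recl !gmulfM i1M i2M IHn //; congr (_ * _).
apply/divg1_eq; rewrite /i1 /i2 -word_val_inv -word_val_cat.
by apply/relator_val/(amalgam_relatorA _ _ (cY ord0)); rewrite ?s1K ?s2K.
Qed.

Let free_void (K : finGroupType) (f : void -> K -> void) B : free_act B f.
Proof. by split; case. Qed.

(** Empty partial actions extend to compatible free actions on [#|G1| * #|G2|] points. [G] acts
    there, so an element of a factor that becomes trivial in [G] fixes a point. *)
Lemma factors_embed :
  (forall x, i1 x = 1 -> x = 1) /\ (forall x, i2 x = 1 -> x = 1).
Proof.
pose z (K : finGroupType) (x : void) (k : K) := x.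
have n_gt0 : 0 < #|G1| * #|G2|.
  by rewrite muln_gt0; apply/andP; split; apply/card_gt0P; exists 1.
have [|||W [_ [d1 [d2 [cardW [fd1 fd2] d12 _ _]]]]] :=
  extend_free_acts (free_void (z A) setT) (free_void (z G1) set0)
    (free_void (z G2) set0) _ _ (dvdn_mulr _ (dvdnn _)) (dvdn_mull _ (dvdnn _))
    _ n_gt0; try by case.
  by rewrite card_void.
have p0 : W by apply: (enum_val (cast_ord (esym cardW) (Ordinal n_gt0))).
have cert : amalgam_certificate [::] (amalgam_act d1 d2) p0.
  exact: amalgam_act_certificate.
split=> x; rewrite -(word_val_nil e) => /(act_val cert p0).
  by rewrite (amalgam_act_inl d2 fd1) s1K => /(free_act_free fd1 (in_setT _)).
by rewrite (amalgam_act_inr d1 fd2) s2K => /(free_act_free fd2 (in_setT _)).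
Qed.

(** * From freeness to certificates *)

Section Completeness.
Variable H : G -> Prop.
Hypotheses (sgH : is_subgroup H) (freeH : is_free H).

Let HM := subgroupM sgH.
Let HV := subgroupV sgH.

(** A coset [H g] is encoded by a chosen element, so that finite sets of cosets are sequences in
    [G]. *)
Let rep g : G := classical_sets.xget 1 (fun y => H (y * g^-1)).

Let repP g : H (rep g * g^-1).
Proof.
apply: (@classical_sets.xgetI G 1 (fun y => H (y * g^-1)) g).
by rewrite mulgV; apply: subgroup1.
Qed.

Let repE g g' : H (g * g'^-1) -> rep g = rep g'.
Proof.
move=> Hg; congr classical_sets.xget; apply: funext => y; apply: propext; split.
  by move/HM/(_ Hg); rewrite mulgA mulgVK.
by move/HM/(_ (HV Hg)); rewrite invMg invgK mulgA mulgVK.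
Qed.

Let rep_inj g g' : rep g = rep g' -> H (g * g'^-1).
Proof.
move=> eq_rep; have := HM (HV (repP g)) (repP g'); rewrite eq_rep.
by rewrite invMg invgK mulgA mulgVK.
Qed.

Let repM g x : rep (rep g * x) = rep (g * x).
Proof. by apply: repE; rewrite invMg mulgA mulgK. Qed.

Let rep_id g : rep (rep g) = rep g.
Proof. exact: repE (repP g). Qed.

Let orbit_reps (K : finGroupType) (iota : K -> G) (T : seq G) :=
  [seq rep (t * iota x) | t <- T, x <- enum K].

Let orbit_repsM (K : finGroupType) (iota : K -> G) T v k :
  {morph iota : x y / x * y} -> v \in orbit_reps iota T ->
  rep (v * iota k) \in orbit_reps iota T.
Proof.
move=> iotaM /allpairsP[[t x] /= [Tt _ ->]]; apply/allpairsP.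
by exists (t, x * k); rewrite mem_enum /= repM iotaM mulgA.
Qed.

Let shift (s : seq G) (v : seq_sub s) (g : G) : seq_sub s :=
  insubd v (rep (val v * g)).

(** If [k] fixes the coset of [v], then [v k v^-1] is an element of finite order of [H], which is
    torsion-free. Stability of [S] ensures that the default in [shift] does not occur on [S]. *)
Let free_shift (s : seq G) (K : finGroupType) (iota : K -> G) (S : seq G) :
  {morph iota : x y / x * y} -> (forall x, iota x = 1 -> x = 1) ->
  {subset S <= s} -> (forall v, v \in S -> rep v = v) ->
  (forall v k, v \in S -> rep (v * iota k) \in S) ->
  free_act [set v : seq_sub s | val v \in S] (fun v k => shift v (iota k)).
Proof.
move=> iotaM iota_ker sSs repS SM.
have iota1 : iota 1 = 1 by apply: (mulgI (iota 1)); rewrite -iotaM !mulg1.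
have shiftE (v : seq_sub s) k : val v \in S ->
    val (shift v (iota k)) = rep (val v * iota k).
  by move=> Sv; rewrite insubdK //; apply: sSs; apply: SM.
split=> [v k|v|v k k'|v k]; rewrite !inE => Sv.
- by rewrite shiftE //; apply: SM.
- by apply: val_inj; rewrite shiftE // iota1 mulg1 repS.
- have Sk : val (shift v (iota k)) \in S by rewrite shiftE //; apply: SM.
  by apply: val_inj; rewrite (shiftE _ k' Sk) !shiftE // repM iotaM mulgA.
move/(congr1 val); rewrite shiftE // -{2}(repS _ Sv) => /rep_inj.
have iotaX n : iota (k ^+ n) = iota k ^+ n.
  by elim: n => // n IHn; rewrite !expgS iotaM IHn.
move=> Hk; apply: iota_ker; apply: (conjg_inj (val v)^-1); rewrite conj1g.
rewrite /conjg invgK mulgA; apply: (is_free_torsion_free (n := #[k].-1) freeH Hk).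
rewrite prednK ?order_gt0 //.
have -> : val v * iota k * (val v)^-1 = iota k ^ (val v)^-1.
  by rewrite /conjg invgK mulgA.
by rewrite -conjXg -iotaX expg_order iota1 conj1g.
Qed.

Lemma free_certificate hs n :
  (forall h, h \in hs -> H (word_val e h)) ->
  #|G1| %| n -> #|G2| %| n -> 0 < n ->
  (\sum_(h <- hs) (size h).+1).+1 * (#|G1| + #|G2|) <= n ->
  exists (W : finType) act (p0 : W), #|W| = n /\ amalgam_certificate hs act p0.
Proof.
move=> hsH dvd1 dvd2 n_gt0 le_n; have [ker1 ker2] := factors_embed.
pose T' := [seq word_val e (take i h) | h <- hs, i <- iota 0 (size h).+1].
(* The element 1 is added so that the base point exists even if [hs] is empty; hence the extra
   successor in the bound. *)
pose T := 1 :: T'.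
pose S1 := orbit_reps i1 T; pose S2 := orbit_reps i2 T.
pose s := undup (S1 ++ S2); pose sT := seq_sub s.
have repS (K : finGroupType) (iota : K -> G) v :
    v \in orbit_reps iota T -> rep v = v.
  by case/allpairsP=> [[t x] [_ _ ->]]; apply: rep_id.
have sS1 : {subset S1 <= s} by move=> v Sv; rewrite mem_undup mem_cat Sv.
have sS2 : {subset S2 <= s} by move=> v Sv; rewrite mem_undup mem_cat Sv orbT.
have fd1 : free_act [set v : sT | val v \in S1] (fun v k => shift v (i1 k)).
  by apply: free_shift => // v; [apply: repS | move=> k; apply: orbit_repsM].
have fd2 : free_act [set v : sT | val v \in S2] (fun v k => shift v (i2 k)).
  by apply: free_shift => // v; [apply: repS | move=> k; apply: orbit_repsM].
(* [A] acts on the union of both parts, since its images lie in both factors and each part is stable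
   under its own factor. *)
have fA : free_act [set: sT] (fun v a => shift v (i1 (phi1 a))).
  have -> : [set: sT] = [set v | val v \in s].
    by apply/setP=> v; rewrite !inE (valP v).
  apply: (free_shift (iota := i1 \o phi1)) => //= [a b|a /ker1 a1|v|v a].
  - by rewrite /= gmulfM i1M.
  - apply: inj_phi1; rewrite a1; apply: (mulgI (phi1 1)).
    by rewrite -gmulfM !mulg1.
  - by rewrite mem_undup mem_cat => /orP[] /repS.
  - rewrite mem_undup mem_cat => /orP[] Sv; rewrite mem_undup mem_cat; apply/orP.
      by left; exact: (@orbit_repsM _ i1 T v (phi1 a) i1M Sv).
    by right; rewrite /= i12; exact: (@orbit_repsM _ i2 T v (phi2 a) i2M Sv).
have leTn : #|{: sT}| <= n.
  rewrite card_seq_sub ?undup_uniq // (leq_trans (size_undup _)) //.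
  rewrite size_cat !size_allpairs -!cardE -mulnDr (leq_trans _ le_n) //.
  rewrite leq_mul2r; apply/orP; right.
  have sizeT' : size T' = \sum_(h <- hs) (size h).+1; last by rewrite -sizeT'.
  rewrite (size_allpairs_dep (fun h i => word_val e (take i h))).
  by rewrite sumnE big_map; apply: eq_bigr => h _; rewrite size_iota.
have [||W [j [d1 [d2 [cardW [fW1 fW2] d12 d1j d2j]]]]] :=
    extend_free_acts fA fd1 fd2 _ _ dvd1 dvd2 leTn n_gt0 => //.
  by move=> v a _; rewrite i12.
have mem1 t : t \in T -> rep t \in S1.
  move=> Tt; apply/allpairsP; exists (t, 1); rewrite mem_enum /= Tt.
  suff -> : i1 1 = 1 by rewrite mulg1.
  by apply: (mulgI (i1 1)); rewrite -i1M !mulg1.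
have mem2 t : t \in T -> rep t \in S2.
  move=> Tt; apply/allpairsP; exists (t, 1); rewrite mem_enum /= Tt.
  suff -> : i2 1 = 1 by rewrite mulg1.
  by apply: (mulgI (i2 1)); rewrite -i2M !mulg1.
pose at_pt g p := exists2 v : sT, val v = rep g & p = j v.
(* The coset of a prefix lies in both parts, so a letter of either factor acts on it as the
   translation. *)
have at_step l g p : g \in T -> at_pt g p ->
    at_pt (g * word_val e [:: l]) (amalgam_act d1 d2 l p).
  move=> Tg [v Dv ->]; case: l => [[y|y] b].
    have Sv : val v \in S1 by rewrite Dv mem1.
    pose k := if b then (e1 y)^-1 else e1 y.
    exists (shift v (i1 k)); last by rewrite -d1j ?inE.
    rewrite insubdK ?Dv ?repM; last first.
      by apply: sS1; rewrite -repM -Dv; apply: orbit_repsM.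
    congr (rep (_ * _)); rewrite /i1; apply: (inl_val (v := [:: (y, b)])).
    by rewrite s1K word_val_cons word_val_nil mulg1.
  have Sv : val v \in S2 by rewrite Dv mem2.
  pose k := if b then (e2 y)^-1 else e2 y.
  exists (shift v (i2 k)); last by rewrite -d2j ?inE.
  rewrite insubdK ?Dv ?repM; last first.
    by apply: sS2; rewrite -repM -Dv; apply: orbit_repsM.
  congr (rep (_ * _)); rewrite /i2; apply: (inr_val (v := [:: (y, b)])).
  by rewrite s2K word_val_cons word_val_nil mulg1.
have T1 : 1 \in T by rewrite inE eqxx.
pose v0 : sT := SeqSub (sS1 _ (mem1 _ T1)).
exists W, (amalgam_act d1 d2), (j v0); split=> //.
apply: amalgam_act_certificate => // h hs_h.
have at_take i : i <= size h ->
    at_pt (word_val e (take i h)) (word_act (amalgam_act d1 d2) (j v0) (take i h)).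
  elim: i => [_|i IHi lt_i]; first by rewrite take0 word_val_nil; exists v0.
  have l0 : (X1 + X2) * bool by case: (h) lt_i.
  rewrite (take_nth l0 lt_i) -cats1 word_val_cat word_act_cat.
  apply: at_step (IHi (ltnW lt_i)); rewrite inE; apply/orP; right.
  by apply/allpairsPdep; exists h, i; rewrite mem_iota ltnS (ltnW lt_i).
(* The full word ends at the coset of an element of [H], the base point. *)
have := at_take _ (leqnn _); rewrite take_size => -[v Dv ->]; congr j.
by apply: val_inj; rewrite Dv; apply: repE; rewrite invg1 mulg1; apply: hsH.
Qed.
End Completeness.
End Amalgam.

(** * Computable functions *)

Section Computability.
Local Open Scope nat_scope.

(* [F] reads its [n] arguments from a list; in a body with bound variables the
   innermost one is at index 0. *)
Definition computable n (F : seq nat -> nat) : Prop :=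
  exists f : recfun n, forall v : n.-tuple nat, computes f v (F v).

Lemma computable_ext n (F F' : seq nat -> nat) :
  (forall v, F v = F' v) -> computable n F -> computable n F'.
Proof. by move=> eqF [f fP]; exists f => v; rewrite -eqF. Qed.

Lemma computable_var n i : i < n -> computable n (fun v => nth 0 v i).
Proof.
by move=> lt_in; exists (RProj (Ordinal lt_in)) => v; rewrite /= (tnth_nth 0).
Qed.

Lemma computable_comp m n (F : seq nat -> nat) (Fs : seq nat -> seq nat) :
  (forall v, size v = n -> size (Fs v) = m) -> computable m F ->
  (forall i, i < m -> computable n (fun v => nth 0 (Fs v) i)) ->
  computable n (fun v => F (Fs v)).
Proof.
move=> sz_Fs [f fP] FsP.
have /choice[g gP] (i : 'I_m) : exists g : recfun n, forall v : n.-tuple nat,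
  computes g v (nth 0 (Fs v) i) by apply: FsP.
exists (RComp f g) => v /=.
have szv : size (Fs v) == m by rewrite sz_Fs ?size_tuple.
by exists (Tuple szv) => [i|]; [rewrite (tnth_nth 0) | apply: fP].
Qed.

Lemma computable_comp1 n (F : nat -> nat) a :
  computable 1 (fun v => F (nth 0 v 0)) -> computable n a ->
  computable n (fun v => F (a v)).
Proof.
by move=> cF ca; apply: (computable_comp (Fs := fun v => [:: a v]) _ cF) => // -[].
Qed.

Lemma computable_succ n a : computable n a -> computable n (fun v => (a v).+1).
Proof.
apply: (computable_comp1 (F := succn)); exists RSucc => v /=.
by case/tupleP: v => x v; rewrite theadE.
Qed.

Lemma computable_const n k : computable n (fun _ => k).
Proof.
elim: k => [|k IHk]; last exact: computable_succ.
apply: (computable_comp (F := fun _ => 0) (m := 0) (Fs := fun _ => [::])) => //.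
by exists RZero.
Qed.

Lemma computable_weaken n k a :
  computable n a -> computable (k + n) (fun v => a (drop k v)).
Proof.
move=> ca; apply: computable_comp ca _ => [v szv|i lt_in].
  by rewrite size_drop szv addKn.
apply: computable_ext (computable_var (i := k + i) _); last by rewrite ltn_add2l.
by move=> v; rewrite nth_drop.
Qed.

Lemma computable_rec n (f k : seq nat -> nat) (g : nat -> nat -> seq nat -> nat) :
  computable n f -> computable n k ->
  computable n.+2 (fun v => g (nth 0 v 0) (nth 0 v 1) (drop 2 v)) ->
  computable n (fun v => nat_rect (fun _ => nat) (f v) (fun i z => g i z v) (k v)).
Proof.
move=> [rf rfP] ck [rg rgP].
pose F v :=
  nat_rect (fun _ => nat) (f (behead v)) (fun i z => g i z (behead v)) (head 0 v).
suff cF : computable n.+1 F.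
  apply: (computable_comp (F := F) (m := n.+1) (Fs := fun v => k v :: v)) => //.
    by move=> v /= ->.
  by case=> [|i] lt_in //=; apply: computable_var.
exists (RPrec rf rg) => v /=; set w := behead_tuple v.
have -> : F v = nat_rect (fun _ => nat) (f w) (fun i z => g i z w) (thead v).
  by rewrite /F; case/tupleP: v @w => x v /=; rewrite theadE.
elim: (thead v) => [|x IHx] /=; first exact: rfP.
exists (nat_rect (fun _ => nat) (f w) (fun i z => g i z w) x) => //.
set y := nat_rect _ _ _ _; have := rgP [tuple of x :: y :: w].
by rewrite /= drop0.
Qed.

Lemma computable_if n (a b : seq nat -> nat) (c : seq nat -> bool) :
  computable n a -> computable n b -> computable n c ->
  computable n (fun v => if c v then a v else b v).
Proof.
move=> ca cb cc; apply: computable_ext (computable_rec (g := fun _ _ => a) cb cc _).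
  by move=> v; case: (c v).
by apply: (computable_weaken 2).
Qed.

Lemma computable_neg n (c : seq nat -> bool) :
  computable n c -> computable n (fun v => ~~ c v).
Proof.
move=> cc; apply: computable_ext
  (computable_if (computable_const n 0) (computable_const n 1) cc).
by move=> v; case: (c v).
Qed.

Lemma computable_and n (b c : seq nat -> bool) :
  computable n b -> computable n c -> computable n (fun v => b v && c v).
Proof.
move=> cb cc; apply: computable_ext (computable_if cc (computable_const n 0) cb).
by move=> v; case: (b v).
Qed.

Lemma computable_or n (b c : seq nat -> bool) :
  computable n b -> computable n c -> computable n (fun v => b v || c v).
Proof.
move=> cb cc; apply: computable_ext (computable_if (computable_const n 1) cc cb).
by move=> v; case: (b v).
Qed.

(** [RMin] looks for a zero, so it is applied to the negation of [p], whose value below [F v] is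
    1. *)
Lemma computable_min n (F : seq nat -> nat) (p : nat -> seq nat -> bool) :
  (forall v, p (F v) v) -> (forall v z, p z v -> F v <= z) ->
  computable n.+1 (fun v => p (nth 0 v 0) (drop 1 v)) -> computable n F.
Proof.
move=> pF F_min /computable_neg[f fP]; exists (RMin f) => v; split.
  by have := fP [tuple of F v :: v]; rewrite /= drop0 pF.
move=> z lt_z; exists 0; have := fP [tuple of z :: v]; rewrite /= drop0.
by case: (boolP (p z v)) => // /F_min; rewrite leqNgt lt_z.
Qed.

Lemma computable_add n a b :
  computable n a -> computable n b -> computable n (fun v => a v + b v).
Proof.
move=> ca cb; apply: computable_ext
  (computable_rec (g := fun _ z _ => z.+1) ca cb _).
  by move=> v; elim: (b v) => [|k /= ->]; rewrite ?addn0 ?addnS.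
by apply: computable_succ; apply: computable_var.
Qed.

Lemma computable_mul n a b :
  computable n a -> computable n b -> computable n (fun v => a v * b v).
Proof.
move=> ca cb; apply: computable_ext
  (computable_rec (g := fun _ z v => z + a v) (computable_const n 0) cb _).
  by move=> v; elim: (b v) => [|k /= ->]; rewrite ?muln0 ?mulnSr.
by apply: computable_add; [apply: computable_var | apply: (computable_weaken 2)].
Qed.

Lemma computable_exp n a b :
  computable n a -> computable n b -> computable n (fun v => a v ^ b v).
Proof.
move=> ca cb; apply: computable_ext
  (computable_rec (g := fun _ z v => z * a v) (computable_const n 1) cb _).
  by move=> v; elim: (b v) => [|k /= ->]; rewrite ?expn0 ?expnSr.
by apply: computable_mul; [apply: computable_var | apply: (computable_weaken 2)].
Qed.

Lemma computable_pred n a : computable n a -> computable n (fun v => (a v).-1).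
Proof.
move=> ca; apply: computable_ext
  (computable_rec (g := fun i _ _ => i) (computable_const n 0) ca _).
  by move=> v; case: (a v).
exact: computable_var.
Qed.

Lemma computable_sub n a b :
  computable n a -> computable n b -> computable n (fun v => a v - b v).
Proof.
move=> ca cb; apply: computable_ext
  (computable_rec (g := fun _ z _ => z.-1) ca cb _).
  by move=> v; elim: (b v) => [|k /= ->]; rewrite ?subn0 ?subnS.
by apply: computable_pred; apply: computable_var.
Qed.

Lemma computable_eq0 n a : computable n a -> computable n (fun v => a v == 0).
Proof.
move=> ca; apply: computable_ext
  (computable_rec (g := fun _ _ _ => 0) (computable_const n 1) ca _).
  by move=> v; case: (a v).
exact: computable_const.
Qed.

Lemma computable_leq n a b :
  computable n a -> computable n b -> computable n (fun v => a v <= b v).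
Proof. by move=> ca cb; apply/computable_eq0/computable_sub. Qed.

Lemma computable_eq n a b :
  computable n a -> computable n b -> computable n (fun v => a v == b v).
Proof.
move=> ca cb; apply: computable_ext
  (computable_and (computable_leq ca cb) (computable_leq cb ca)).
by move=> v; rewrite eqn_leq.
Qed.

Lemma computable_div n a b :
  computable n a -> computable n b -> computable n (fun v => a v %/ b v).
Proof.
move=> ca cb; apply: (computable_min
  (p := fun z v => (b v == 0) || (a v < z.+1 * b v))).
- by move=> v; case: posnP => //= b_gt0; apply: ltn_ceil.
- move=> v z; case: posnP => [-> _|b_gt0 /=]; first by rewrite divn0.
  by rewrite -ltn_divLR.
have cb1 := computable_weaken 1 cb; have ca1 := computable_weaken 1 ca.
apply: computable_or; first exact: computable_eq0.
apply: computable_leq; first exact: computable_succ.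
by apply: computable_mul cb1; apply/computable_succ/computable_var.
Qed.

Lemma computable_mod n a b :
  computable n a -> computable n b -> computable n (fun v => a v %% b v).
Proof.
move=> ca cb; apply: computable_ext
  (computable_sub ca (computable_mul (computable_div ca cb) cb)).
by move=> v; rewrite {1}(divn_eq (a v) (b v)) addKn.
Qed.

Lemma computable_odd n a : computable n a -> computable n (fun v => odd (a v)).
Proof.
move=> ca; apply: computable_ext (computable_mod ca (computable_const n 2)).
by move=> v; rewrite modn2.
Qed.

Lemma computable_all n (k : seq nat -> nat) (p : nat -> seq nat -> bool) :
  computable n k -> computable n.+1 (fun v => p (nth 0 v 0) (drop 1 v)) ->
  computable n (fun v => all (p^~ v) (iota 0 (k v))).
Proof.
move=> ck cp; apply: computable_ext
  (computable_rec (g := fun i z v => z * p i v) (computable_const n 1) ck _).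
  move=> v; elim: (k v) => // m IHm.
  by rewrite [LHS]/= IHm -[in RHS]addn1 iotaD all_cat /= andbT mulnb.
apply: computable_mul; first exact: computable_var.
have: computable n.+2 (fun v => p (nth 0 (nth 0 v 0 :: drop 2 v) 0)
    (drop 1 (nth 0 v 0 :: drop 2 v))).
  apply: (computable_comp (Fs := fun v => nth 0 v 0 :: drop 2 v)) cp _.
    by move=> v szv; rewrite /= size_drop szv subn2.
  case=> [|i] lt_i; first exact: computable_var.
  apply: computable_ext (computable_var (i := i.+2) _) => // v.
  by rewrite /= nth_drop.
by apply: computable_ext => v; rewrite /= drop0.
Qed.

Lemma computable_has n (k : seq nat -> nat) (p : nat -> seq nat -> bool) :
  computable n k -> computable n.+1 (fun v => p (nth 0 v 0) (drop 1 v)) ->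
  computable n (fun v => has (p^~ v) (iota 0 (k v))).
Proof.
move=> ck cp; apply: computable_ext
  (computable_neg (computable_all (p := fun i v => ~~ p i v) ck _)).
  by move=> v; congr nat_of_bool; rewrite -has_predC; apply: eq_has => i /=;
     rewrite negbK.
exact: computable_neg.
Qed.

(** The list is fixed and is unfolded into the recursive function; the finite data of the amalgam
    enter the algorithm in this way. *)
Lemma computable_all_seq n (T : Type) (L : seq T) (p : T -> seq nat -> bool) :
  (forall x, computable n (p x)) -> computable n (fun v => all (p^~ v) L).
Proof.
move=> cp; elim: L => [|x L IHL] /=; first exact: computable_const.
exact: computable_and.
Qed.

(** * Arithmetic of codes of lists *)

Definition code_head c := head 0 (CodeSeq.decode c).
Definition code_tail c := CodeSeq.code (behead (CodeSeq.decode c)).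
Definition code_drop i c := iter i code_tail c.

Lemma code_head_code x s : code_head (CodeSeq.code (x :: s)) = x.
Proof. by rewrite /code_head CodeSeq.codeK. Qed.

Lemma code_drop_code i s :
  code_drop i (CodeSeq.code s) = CodeSeq.code (drop i s).
Proof.
elim: i => [|i IHi]; first by rewrite drop0.
rewrite /code_drop iterS -/(code_drop i _) IHi /code_tail CodeSeq.codeK.
by rewrite -drop1 drop_drop.
Qed.

Lemma code_eq0 s : (CodeSeq.code s == 0) = nilp s.
Proof. by case: s => //= x s; rewrite muln_eq0 expn_eq0. Qed.

(** A code thus bounds every loop over the list that it encodes, and the code of the input bounds
    the number of prefixes. *)
Lemma size_code s : \sum_(x <- s) x.+1 <= CodeSeq.code s.
Proof.
elim: s => [|x s IHs]; first by rewrite big_nil.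
rewrite big_cons /= -muln2; apply: (@leq_trans (x.+1 * (CodeSeq.code s * 2).+1)).
  by rewrite mulnS leq_add2l mulnC -mulnA (leq_trans IHs) // leq_pmulr.
by rewrite leq_mul2r ltn_expl ?orbT.
Qed.

Lemma leq_size_code s : size s <= CodeSeq.code s.
Proof.
by apply: leq_trans (size_code s); rewrite -sum1_size leq_sum.
Qed.

(** The code of [x :: s] is [2 ^ x] times an odd number, so the head is the exponent of 2. The code
    0 is singled out so that the minimization halts. *)
Lemma computable_code_head n a :
  computable n a -> computable n (fun v => code_head (a v)).
Proof.
move=> ca; apply: (computable_min
  (p := fun z v => (a v == 0) || odd (a v %/ 2 ^ z))).
- move=> v; rewrite -(CodeSeq.decodeK (a v)); case: CodeSeq.decode => //= x s.
  by rewrite code_head_code mulKn ?expn_gt0 //= odd_double orbT.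
- move=> v z; rewrite -(CodeSeq.decodeK (a v)); case: CodeSeq.decode => // x s.
  rewrite code_head_code code_eq0 /=; case: leqP => // lt_zx.
  rewrite -(subnKC (ltnW lt_zx)) expnD -mulnA mulKn ?expn_gt0 // oddM oddX.
  by rewrite subn_eq0 leqNgt lt_zx.
have ca1 := computable_weaken 1 ca; have cz := @computable_var n.+1 0 isT.
apply: computable_or; first exact: computable_eq0.
exact/computable_odd/computable_div/computable_exp/cz/computable_const.
Qed.

(** Removing the power of 2 leaves twice the code of the tail plus one; halving rounds this down. *)
Lemma computable_code_drop n k a : computable n k ->
  computable n a -> computable n (fun v => code_drop (k v) (a v)).
Proof.
move=> ck ca; apply: computable_ext
  (computable_rec (g := fun _ z _ => z %/ 2 ^ code_head z %/ 2) ca ck _).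
  move=> v; elim: (k v) => //= i ->; set z := code_drop i _.
  rewrite -(CodeSeq.decodeK z).
  case: CodeSeq.decode => [|x s]; first by rewrite div0n.
  rewrite code_head_code /code_tail CodeSeq.codeK /= mulKn ?expn_gt0 //.
  by rewrite divn2 /= uphalf_double.
have cz := @computable_var n.+2 1 isT.
apply: computable_div (computable_const _ 2); apply: (computable_div cz).
exact: computable_exp (computable_const _ 2) (computable_code_head cz).
Qed.

(* The digits of [z] in base [n] tabulate an action on [0, n) of [k] letters. *)
Definition digit z n j := z %/ n ^ j %% n.

Lemma digits_exist n m (d : nat -> nat) : (forall j, d j < n) ->
  exists2 z, z < n ^ m & forall j, j < m -> digit z n j = d j.
Proof.
move=> d_lt; have n_gt0 : 0 < n := leq_ltn_trans (leq0n _) (d_lt 0).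
elim: m d d_lt => [|m IHm] d d_lt; first by exists 0.
have [z z_lt zd] := IHm (fun j => d j.+1) (fun j => d_lt j.+1).
exists (z * n + d 0).
  rewrite expnSr (@leq_trans (z.+1 * n)) ?leq_mul2r ?z_lt ?orbT //.
  by rewrite mulSn addnC ltn_add2r.
case=> [_|j lt_jm]; rewrite /digit.
  by rewrite expn0 divn1 modnMDl modn_small.
by rewrite expnS divnMA divnMDl // (divn_small (d_lt 0)) addn0; apply: zd.
Qed.

(** The point stays put once the word is exhausted, so the code of the word can serve as the number
    of steps. *)
Definition run_steps k z n c p := nat_rect (fun _ => nat) p (fun i q =>
  if code_drop i c == 0 then q
  else digit z n (q * k + code_head (code_drop i c))).

Lemma run_stepsE k z n s p i : run_steps k z n (CodeSeq.code s) p i =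
  foldl (fun q l => digit z n (q * k + l)) p (take i s).
Proof.
elim: i => [|i IHi]; first by rewrite take0.
rewrite [LHS]/= {}IHi code_drop_code code_eq0.
have [le_si|lt_is] := leqP (size s) i.
  by rewrite drop_oversize // !take_oversize // ltnW.
rewrite (drop_nth 0 lt_is) code_head_code (take_nth 0 lt_is).
by rewrite -cats1 foldl_cat.
Qed.

Definition run_word k z n c p := run_steps k z n c p c.

Lemma run_word_code k z n s p : run_word k z n (CodeSeq.code s) p =
  foldl (fun q l => digit z n (q * k + l)) p s.
Proof. by rewrite /run_word run_stepsE take_oversize // leq_size_code. Qed.

Lemma computable_run_word k m z n c p :
  computable m z -> computable m n -> computable m c -> computable m p ->
  computable m (fun v => run_word k (z v) (n v) (c v) (p v)).
Proof.
move=> cz cn cc cp; apply: (computable_rec (g := fun i q v =>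
  if code_drop i (c v) == 0 then q
  else digit (z v) (n v) (q * k + code_head (code_drop i (c v))))) => //.
have ci := @computable_var m.+2 0 isT; have cq := @computable_var m.+2 1 isT.
have cc2 := computable_weaken 2 cc; have cz2 := computable_weaken 2 cz.
have cn2 := computable_weaken 2 cn; have cdrop := computable_code_drop ci cc2.
apply: computable_if (computable_eq0 cdrop) => //.
apply: (computable_mod _ cn2); apply: (computable_div cz2).
apply: (computable_exp cn2).
apply: computable_add (computable_code_head cdrop).
exact: computable_mul cq (computable_const _ k).
Qed.

End Computability.

(** * Bounded search for a certificate *)

Section Decision.
Local Open Scope nat_scope.
Variables (X : finType) (pos neg : seq (word X)) (N : nat).
Let k := #|{: X * bool}|.

Definition word_code (w : word X) :=
  CodeSeq.code [seq nat_of_ord (enum_rank l) | l <- w].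

Definition check_certificate n c z q :=
  let run r p := run_word k z n (word_code r) p in
  [&& all (fun r => all (fun p => run r p == p) (iota 0 n)) pos,
      all (fun r => all (fun p => run r p != p) (iota 0 n)) neg &
      all (fun i => (code_drop i c == 0)
        || (run_word k z n (code_head (code_drop i c)) q == q)) (iota 0 c)].

(** A table has [n * k] digits in base [n], so the bound on [z] covers all actions of the letters on
    [n] points. *)
Definition exists_certificate c := let n := N * c.+1 in
  has (fun z => has (fun q => check_certificate n c z q) (iota 0 n))
    (iota 0 (n ^ (n * k))).

Lemma computable_check_certificate m n c z q :
  computable m n -> computable m c -> computable m z -> computable m q ->
  computable m (fun v => check_certificate (n v) (c v) (z v) (q v)).
Proof.
move=> cn cc cz cq.
have cn1 := computable_weaken 1 cn; have cc1 := computable_weaken 1 cc.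
have cz1 := computable_weaken 1 cz; have cq1 := computable_weaken 1 cq.
have cv := @computable_var m.+1 0 isT.
have crun w : computable m.+1
    (fun v => run_word k (z (drop 1 v)) (n (drop 1 v)) (word_code w) (nth 0 v 0)).
  exact: computable_run_word cz1 cn1 (computable_const _ _) cv.
apply: computable_and; last apply: computable_and.
- apply: (computable_all_seq pos (p := fun r v =>
    all (fun p => run_word k (z v) (n v) (word_code r) p == p) (iota 0 (n v)))).
  move=> r; apply: (computable_all (p := fun p v =>
    run_word k (z v) (n v) (word_code r) p == p) cn).
  exact: computable_eq (crun r) cv.
- apply: (computable_all_seq neg (p := fun r v =>
    all (fun p => run_word k (z v) (n v) (word_code r) p != p) (iota 0 (n v)))).
  move=> r; apply: (computable_all (p := fun p v =>
    run_word k (z v) (n v) (word_code r) p != p) cn).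
  exact: computable_neg (computable_eq (crun r) cv).
apply: (computable_all (p := fun i v => (code_drop i (c v) == 0)
  || (run_word k (z v) (n v) (code_head (code_drop i (c v))) (q v) == q v)) cc).
have cdrop := computable_code_drop cv cc1.
apply: computable_or (computable_eq0 cdrop) _; apply: (computable_eq _ cq1).
exact: computable_run_word cz1 cn1 (computable_code_head cdrop) cq1.
Qed.

Lemma computable_exists_certificate :
  computable 1 (fun v => exists_certificate (nth 0 v 0)).
Proof.
have cn m i : i < m -> computable m (fun v => N * (nth 0 v i).+1).
  move=> lt_im; apply: computable_mul (computable_const _ _) _.
  exact/computable_succ/computable_var.
have drop1 i v : nth 0 (drop 1 v) i = nth 0 v i.+1 by rewrite nth_drop.
apply: (computable_has (p := fun z v => has (fun q =>
  check_certificate (N * (nth 0 v 0).+1) (nth 0 v 0) z q)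
  (iota 0 (N * (nth 0 v 0).+1)))).
  apply: computable_exp (cn _ _ _) _ => //.
  exact: computable_mul (cn _ _ _) (computable_const _ _).
apply: computable_ext (computable_has (n := 2) (k := fun v => N * (nth 0 v 1).+1)
  (p := fun q v => check_certificate (N * (nth 0 v 1).+1) (nth 0 v 1) (nth 0 v 0) q)
  _ _); first by move=> v; rewrite !drop1.
  exact: cn.
apply: computable_ext (computable_check_certificate (cn 3 2 isT)
  (@computable_var 3 2 isT) (@computable_var 3 1 isT)
  (@computable_var 3 0 isT)).
by move=> v; rewrite !drop1.
Qed.

Section Table.
Variables (n z : nat) (W : finType) (act : X * bool -> W -> W) (f : W -> nat).
Hypotheses (f_inj : injective f) (f_lt : forall p, f p < n).
Hypothesis f_surj : forall i, i < n -> exists p, f p = i.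
Hypothesis actE : forall l p, digit z n (f p * k + enum_rank l) = f (act l p).

Lemma run_word_act w p :
  run_word k z n (word_code w) (f p) = f (word_act act p w).
Proof. by rewrite run_word_code; elim: w p => //= l w IHw p; rewrite actE IHw. Qed.

Lemma check_certificateP hs q :
  reflect (certificate pos neg hs act q)
    (check_certificate n (words_code hs) z (f q)).
Proof.
have fixE w p :
    (run_word k z n (word_code w) (f p) == f p) = (word_act act p w == p).
  by rewrite run_word_act (inj_eq f_inj).
have mem_iota0 m i : (i \in iota 0 m) = (i < m) by rewrite mem_iota add0n.
have codeE : words_code hs = CodeSeq.code (map word_code hs) by [].
have nthE i : i < size hs ->
    (code_drop i (words_code hs) == 0) || (run_word k z n
       (code_head (code_drop i (words_code hs))) (f q) == f q) =
    (word_act act q (nth [::] hs i) == q).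
  move=> lt_i; rewrite codeE code_drop_code code_eq0.
  by rewrite (drop_nth 0) ?size_map //= code_head_code (nth_map [::]) //.
apply: (iffP and3P) => [[/allP posP /allP negP /allP hsP]|[posP negP hsP]].
  split=> [r p /posP/allP|r p /negP/allP|h hs_h].
  - by move/(_ (f p)); rewrite mem_iota0 fixE => /(_ (f_lt p))/eqP.
  - by move/(_ (f p)); rewrite mem_iota0 fixE => /(_ (f_lt p))/eqP.
  - have lt_i : index h hs < size hs by rewrite index_mem.
    have /hsP : index h hs \in iota 0 (words_code hs).
      rewrite mem_iota0 (leq_trans lt_i) // codeE -(size_map word_code).
      exact: leq_size_code.
    by rewrite nthE // nth_index // => /eqP.
split; apply/allP.
- move=> r /posP rP; apply/allP => i; rewrite mem_iota0 => /f_surj[p <-].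
  by rewrite fixE rP.
- move=> r /negP rP; apply/allP => i; rewrite mem_iota0 => /f_surj[p <-].
  by rewrite fixE; apply/eqP.
- move=> i _; have [le_i|lt_i] := leqP (size hs) i.
    by rewrite codeE code_drop_code drop_oversize ?size_map.
  by rewrite nthE // hsP // mem_nth.
Qed.

End Table.

Lemma exists_certificateP hs : 0 < N ->
  reflect (exists (W : finType) act (p0 : W),
             #|W| = N * (words_code hs).+1 /\ certificate pos neg hs act p0)
    (exists_certificate (words_code hs)).
Proof.
move=> N_gt0; rewrite /exists_certificate; set c := words_code hs.
set n := N * c.+1; have n_gt0 : 0 < n by rewrite muln_gt0 N_gt0.
apply: (iffP hasP) => [[z _ /hasP[q]]|[W [act [p0 [cardW cert]]]]].
  rewrite mem_iota add0n => lt_qn checkq.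
  pose act (l : X * bool) (p : 'I_n) :=
    Ordinal (ltn_pmod (z %/ n ^ (p * k + enum_rank l)) n_gt0).
  exists 'I_n, act, (Ordinal lt_qn); rewrite card_ord; split=> //.
  apply/(@check_certificateP n z _ act (@nat_of_ord n)).
  - exact: val_inj.
  - by move=> p; apply: ltn_ord.
  - by move=> i lt_i; exists (Ordinal lt_i).
  - by [].
  - exact: checkq.
pose f (p : W) : nat := enum_rank p.
have f_inj : injective f by move=> p q /val_inj/enum_rank_inj.
have f_lt p : f p < n by rewrite -cardW; apply: ltn_ord.
have f_surj i : i < n -> exists p, f p = i.
  rewrite -cardW => lt_i; exists (enum_val (Ordinal lt_i)).
  by rewrite /f enum_valK.
(* Position [q * k + l] holds the image of the point of rank [q] under the letter of rank [l]. The
   default 0 occurs only when there are no letters. *)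
pose d j := if [pick l : X * bool | enum_rank l == j %% k :> nat] is Some l
  then f (act l (nth p0 (enum W) (j %/ k))) else 0.
have [z lt_z zP] : exists2 z, z < n ^ (n * k) &
    forall j, j < n * k -> digit z n j = d j.
  by apply: digits_exist => j; rewrite /d; case: pickP.
have actE l p : digit z n (f p * k + enum_rank l) = f (act l p).
  have lt_l : enum_rank l < k := ltn_ord _.
  have k_gt0 : 0 < k := leq_ltn_trans (leq0n _) lt_l.
  rewrite zP; last first.
    rewrite (@leq_trans ((f p).+1 * k)) ?leq_mul2r ?f_lt ?orbT //.
    by rewrite mulSn addnC ltn_add2r.
  rewrite /d modnMDl divnMDl // (modn_small lt_l) (divn_small lt_l) addn0.
  rewrite nth_enum_rank; case: pickP => [l' /eqP/val_inj/enum_rank_inj-> //|/(_ l)].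
  by rewrite eqxx.
exists z; first by rewrite mem_iota.
apply/hasP; exists (f p0); first by rewrite mem_iota f_lt.
by apply/(check_certificateP f_inj f_lt f_surj actE).
Qed.

End Decision.

Theorem corollary6p7
    (X1 X2 : finType) (R1 : seq (word X1)) (R2 : seq (word X2))
    (G1 G2 : finGroupType) (e1 : X1 -> G1) (e2 : X2 -> G2)
    (presG1 : presents (fun _ : G1 => True) e1 (fun r => r \in R1))
    (presG2 : presents (fun _ : G2 => True) e2 (fun r => r \in R2))
    (A : finGroupType) (Y : {set A}) (genY : (<<Y>> = [set: A])%g)
    (phi1 : {multiplicative A -> G1}) (phi2 : {multiplicative A -> G2})
    (inj_phi1 : injective phi1) (inj_phi2 : injective phi2)
    (G : groupType) (e : X1 + X2 -> G)
    (presG : presents (fun _ : G => True) e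
               (amalgam_relator R1 R2 e1 e2 Y phi1 phi2)) :
  exists f : recfun 1,
    decides f (fun hs : seq (word (X1 + X2)%type) =>
      is_free (generated_by (fun i : 'I_(size hs) => word_val e (nth [::] hs i)))).
Proof.
(* These choices affect only the two finite lists built into the algorithm, not its
   computability. *)
have /choice[s1 s1K] : forall g, exists w, word_val e1 w = g.
  by move=> g; apply: (presG1.1 g).1.
have /choice[s2 s2K] : forall g, exists w, word_val e2 w = g.
  by move=> g; apply: (presG2.1 g).1.
pose pos := trivial_words R1 R2 phi1 phi2 s1 s2; pose neg := nontrivial_words s1 s2.
(* Twice the product is a multiple of both orders and at least their sum. *)
pose N := (#|G1| * #|G2|).*2.
have G1_gt0 : 0 < #|G1| by apply/card_gt0P; exists 1.
have G2_gt0 : 0 < #|G2| by apply/card_gt0P; exists 1.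
have N_gt0 : 0 < N by rewrite double_gt0 muln_gt0 G1_gt0.
have [f fP] := computable_exists_certificate pos neg N.
have certP hs := exists_certificateP pos neg hs N_gt0.
exists f => hs; have {fP} := fP [tuple words_code hs]; rewrite /=.
set P := is_free _.
suff -> : exists_certificate pos neg N (words_code hs) = `[< P >].
  by case: asboolP => Pn fPn; split.
apply/(sameP (certP hs))/(iffP (asboolP _)) => [freeH|[W [act [p0 [_ cert]]]]].
  apply: (free_certificate presG1 presG2 genY inj_phi1 inj_phi2 presG s1K s2K
           (generated_subgroup _) freeH).
  - move=> h hs_h; have lt_h : index h hs < size hs by rewrite index_mem.
    by have := generated_gen (fun i : 'I_(size hs) => word_val e (nth [::] hs i))
      (Ordinal lt_h); rewrite /= nth_index.
  - by rewrite /N -muln2 -!mulnA dvdn_mulr.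
  - by rewrite /N -muln2 mulnAC -!mulnA mulnCA dvdn_mulr.
  - by rewrite muln_gt0 N_gt0.
  - rewrite mulnC leq_mul //.
      rewrite /N -addnn leq_add //.
        by rewrite leq_pmulr.
      by rewrite leq_pmull.
    (* Each word is at most as long as its code, so [size_code] for the list of codes bounds the
       number of prefixes. *)
    rewrite ltnS; apply: leq_trans (size_code _).
    rewrite big_map leq_sum // => h _; rewrite ltnS.
    by rewrite -(size_map (fun l => nat_of_ord (enum_rank l)) h) leq_size_code.
exact: (certificate_free presG1 presG2 presG s1K s2K cert).
Qed.
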